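(* Let $n\ge 1$, $N=2^n$, $m\ge 1$, and let $V_0,\dots,V_{N-1}$ be unitary operators on $m$ qubits. There exists a quantum circuit acting on an $n$-qubit selection register, an $m$-qubit target register and $\log_2^* n$ clean ancilla qubits that implements the unary iteration unitary $$U=\sum_{i=0}^{N-1}|i\rangle\langle i|\otimes V_i$$ on the selection and target registers, and that consists of at most $2.5N$ Toffoli gates together with Clifford operations (Clifford gates, single-qubit measurements and classically controlled Clifford gates) and, for each $i\in\{0,\dots,N-1\}$, one application of the singly controlled operation controlled-$V_i$ on the target register.
   Context: The selection register stores an integer $i\in\{0,\dots,N-1\}$ in binary. Controlled-$V_i$ has a single control qubit and applies $V_i$ to the target register if the control is $|1\rangle$ and the identity otherwise. $\log_2^* n$ is the iterated logarithm: the number of times $\log_2$ must be applied, starting from $n$, until the result is at most $1$. A Toffoli gate with controls $x,y$ and target $z$ (three distinct qubits) maps $|x,y,z\rangle\mapsto|x,y,z\oplus (x\wedge y)\rangle$. A clean ancilla qubit is a qubit that is guaranteed to be in state $|0\rangle$ at the start of the circuit and must be returned to $|0\rangle$ at the end, for every input on the other qubits. Measurement-based uncomputation is permitted on clean ancillae: a clean ancilla holding the AND of two other qubits may be reset to $|0\rangle$ by measuring it in the $X$ basis and applying a classically controlled Clifford correction, which costs no Toffoli gate. *)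

(* Defs.v *)
From HB Require Import structures.
From mathcomp Require Import all_boot all_order all_algebra.
From mathcomp Require Import spectral sesquilinear.
From mathcomp Require Import complex mxtens.
From mathcomp Require Import reals exp.

Set Implicit Arguments.
Unset Strict Implicit.
Unset Printing Implicit Defensive.

Import Order.TTheory GRing.Theory Num.Theory.
Local Open Scope ring_scope.
Local Open Scope sesquilinear_scope.

Definition log2 (R : realType) (x : R) : R := ln x / ln 2.

Lemma log2star_ex (R : realType) (n : nat) :
  exists k, iter k (@log2 R) n%:R <= 1.
Proof.
suff tower k (x : R) : x <= (iter k (expn 2) 1%N)%:R ->
    exists j, iter j (@log2 R) x <= 1.
  apply: (tower n); rewrite ler_nat.
  by elim: n => //= n IHn; exact: leq_ltn_trans IHn (ltn_expl _ _).
elim: k x => [|k IHk] x /= hx; first by exists 0%N.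
have [x1|x1] := leP x 1; first by exists 0%N.
have [|j hj] := IHk (log2 x); last by exists j.+1; rewrite iterSr.
have l2 : 0 < ln 2 :> R by rewrite ln_gt0 // ltr1n.
rewrite /log2 ler_pdivrMr // mulr_natl -lnXn ?ltr0n // -natrX.
by rewrite ler_ln ?posrE ?(lt_trans ltr01 x1) // ltr0n expn_gt0.
Qed.

(* [iter k log2 n] is only compared with 1 until it first drops to at most 1,
   so the value of [ln] at nonpositive arguments plays no role. *)
Definition log2star (R : realType) (n : nat) : nat := ex_minn (log2star_ex R n).

(* The [n + m + a] qubits: selection register, target register, ancillae. *)
Notation wire n m a := ('I_n + 'I_m + 'I_a)%type.

(* Qubit [j] of a register holds the bit of weight [2 ^ j]. *)
Definition nat_bit (x j : nat) : bool := odd (x %/ 2 ^ j)%N.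

(* The bit string of a computational basis state of the whole system, whose
   space is (selection) (x) (target) (x) (ancillae). *)
Definition bits n m a (x : 'I_(2 ^ n * 2 ^ m * 2 ^ a)) :
    {ffun wire n m a -> bool} :=
  let: (st, anc) := mxtens_unindex x in
  let: (sel, tgt) := mxtens_unindex st in
  [ffun w : wire n m a => match w with
  | inl (inl j) => nat_bit sel j
  | inl (inr j) => nat_bit tgt j
  | inr j => nat_bit anc j
  end].

Inductive clifford n m a :=
  | HGate of wire n m a
  | SGate of wire n m a
  | CNOT of wire n m a & wire n m a. (* control, target *)

(* [Measure q] measures in the computational basis and appends the outcome to
   the classical record (most recent outcome first); [CondClifford f g] applies
   [g] exactly when [f] holds of the current record.  [CtrlV i q] is
   controlled-V_i with control [q]. *)
Inductive instr n m a :=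
  | Clifford of clifford n m a
  | Measure of wire n m a
  | CondClifford of (seq bool -> bool) & clifford n m a
  | Toffoli of wire n m a & wire n m a & wire n m a (* controls, target *)
  | CtrlV of 'I_(2 ^ n) & wire n m a.

Definition circuit n m a := seq (instr n m a).

Definition is_target n m a (q : wire n m a) : bool :=
  if q is inl (inr _) then true else false.

Definition wf_clifford n m a (g : clifford n m a) : bool :=
  if g is CNOT c t then c != t else true.

Definition wf_instr n m a (g : instr n m a) : bool :=
  match g with
  | Clifford g | CondClifford _ g => wf_clifford g
  | Measure _ => true
  | Toffoli c1 c2 t => uniq [:: c1; c2; t]
  | CtrlV _ q => ~~ is_target q
  end.

Definition wf_circuit n m a (c : circuit n m a) : bool :=
  all (@wf_instr n m a) c.

Definition is_toffoli n m a (g : instr n m a) : bool :=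
  if g is Toffoli _ _ _ then true else false.

Definition is_ctrlV n m a (i : 'I_(2 ^ n)) (g : instr n m a) : bool :=
  if g is CtrlV j _ then j == i else false.

Definition toffoli_count n m a (c : circuit n m a) : nat :=
  count (@is_toffoli n m a) c.

Definition ctrlV_count n m a (i : 'I_(2 ^ n)) (c : circuit n m a) : nat :=
  count (is_ctrlV i) c.

Section Semantics.
Context (C : numClosedFieldType) (n m a : nat).
Local Notation D := (2 ^ n * 2 ^ m * 2 ^ a)%N.
Local Notation qubit := (wire n m a).

(* The operator |y> |-> |f y> on bit strings. *)
Definition basis_map (f : {ffun qubit -> bool} -> {ffun qubit -> bool}) : 'M[C]_D :=
  \matrix_(x, y) (bits x == f (bits y))%:R.

(* The one-qubit operator with entries [<b| g |b'> = g b b'] on qubit [q]. *)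
Definition on_qubit (g : bool -> bool -> C) (q : qubit) : 'M[C]_D :=
  \matrix_(x, y)
    if [forall w, (w != q) ==> (bits x w == bits y w)]
    then g (bits x q) (bits y q) else 0.

Definition hadamard (b b' : bool) : C := (-1) ^+ (b && b') / sqrtC 2.
Definition phase (b b' : bool) : C :=
  if b == b' then (if b then 'i else 1) else 0.

Definition cnot_mx (c t : qubit) : 'M[C]_D :=
  basis_map (fun y => [ffun w => if w == t then y t (+) y c else y w]).

Definition toffoli_mx (c1 c2 t : qubit) : 'M[C]_D :=
  basis_map
    (fun y => [ffun w => if w == t then y t (+) (y c1 && y c2) else y w]).

Definition clifford_mx (g : clifford n m a) : 'M[C]_D :=
  match g with
  | HGate q => on_qubit hadamard q
  | SGate q => on_qubit phase q
  | CNOT c t => cnot_mx c t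
  end.

Definition qubit_proj (q : qubit) (b : bool) : 'M[C]_D :=
  \matrix_(x, y) ((x == y) && (bits x q == b))%:R.

Definition ctrlV_mx (V : 'M[C]_(2 ^ m)) (q : qubit) : 'M[C]_D :=
  qubit_proj q false + qubit_proj q true *m (1%:M *t V *t 1%:M).

(* [run V c h rho]: the final state, averaged over measurement outcomes, of [c]
   started in the density operator [rho] with classical record [h].  After a
   measurement the two branches carry the unnormalised post-measurement states,
   so that probabilities are accounted for. *)
Fixpoint run (V : 'I_(2 ^ n) -> 'M[C]_(2 ^ m)) (c : circuit n m a)
    (h : seq bool) (rho : 'M[C]_D) : 'M[C]_D :=
  let evolve A := A *m rho *m A^t* in
  match c with
  | [::] => rho
  | Clifford g :: c' => run V c' h (evolve (clifford_mx g))
  | Measure q :: c' =>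
      run V c' (false :: h) (evolve (qubit_proj q false)) +
      run V c' (true :: h) (evolve (qubit_proj q true))
  | CondClifford f g :: c' =>
      run V c' h (if f h then evolve (clifford_mx g) else rho)
  | Toffoli c1 c2 t :: c' => run V c' h (evolve (toffoli_mx c1 c2 t))
  | CtrlV i q :: c' => run V c' h (evolve (ctrlV_mx (V i) q))
  end.

(* |0...0><0...0| on the ancillae. *)
Definition clean : 'M[C]_(2 ^ a) :=
  \matrix_(x, y) ((x == 0%N :> nat) && (y == 0%N :> nat))%:R.

(* With the ancillae prepared in |0...0>, [c] acts as the channel
   rho |-> W rho W^* on selection and target and returns the ancillae to
   |0...0>.  Quantifying over all operators [rho] is, by linearity, the same as
   quantifying over density operators. *)
Definition implements (V : 'I_(2 ^ n) -> 'M[C]_(2 ^ m)) (c : circuit n m a)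
    (W : 'M[C]_(2 ^ n * 2 ^ m)) : Prop :=
  forall rho : 'M[C]_(2 ^ n * 2 ^ m),
    run V c [::] (rho *t clean) = (W *m rho *m W^t*) *t clean.

End Semantics.

Definition unary_iteration (C : numClosedFieldType) (n m : nat)
    (V : 'I_(2 ^ n) -> 'M[C]_(2 ^ m)) : 'M[C]_(2 ^ n * 2 ^ m) :=
  \sum_(i < 2 ^ n) delta_mx i i *t V i.

(* Main.v *)
Require Import Defs.
From HB Require Import structures.
From mathcomp Require Import all_boot all_order all_algebra.
From mathcomp Require Import spectral sesquilinear.
From mathcomp Require Import complex mxtens.
From mathcomp Require Import reals exp zify ring lra.

(** No measurement is needed, and at most three ancillae [f], [g], [l] are
    used.  For [n >= 5], split the selection register into [k] top wires and [t]
    low wires with [t = k + 1] or [t = k + 2].  The flag [f] holds the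
    conjunction of the top wires, and NOT gates applied in Gray-code order make
    it the indicator of each top value in turn; one change of the flag costs the conjunction of
    [k - 1] wires, computed with borrowed low wires in at most [2^(k-1) - 2]
    Toffoli gates.  Where the flag is set, the top wires have a known value, so
    they serve as conditionally clean workspace for a binary tree that computes
    the indicators [w] of the values of the low wires other than the last two
    ([a] and [b]), and for the product [a && b].  For each of these values,
    [g = f && w] is a genuine indicator, and the four values of [a], [b] are
    visited in Gray-code order with five Toffoli gates acting on [l], the
    control of the selected unitary.  A block of [2^t] values thus costs
    [9/4 * 2^t - 2] Toffoli gates, and the flag changes fit into the remaining
    [1/4 * 2^t].

    Every gate but controlled-V permutes the computational basis and leaves the
    target alone, so correctness is a statement about the Boolean simulation of
    the control wires together with the list of unitaries that fire. *)

Set Implicit Arguments.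
Unset Strict Implicit.
Unset Printing Implicit Defensive.

(** * Reversible circuits on Boolean wires *)

Section Reversible.
Context (Q : finType).
Local Notation state := {ffun Q -> bool}.
Implicit Types (s lab i : state) (q w : Q).

(** [CV] names its unitary by a whole Boolean state, of which only the address wires count. A NOT
    gate on an address wire then changes the label by [tog], without arithmetic on indices. *)
Inductive gate :=
  | NOT of Q
  | CX of Q & Q
  | CCX of Q & Q & Q
  | CV of state & Q.

Definition tog q (e : bool) s : state := [ffun w => s w (+) ((w == q) && e)].

Definition gate_act g s : state :=
  match g with
  | NOT q => tog q true s
  | CX c t => tog t (s c) s
  | CCX c1 c2 t => tog t (s c1 && s c2) s
  | CV _ _ => s
  end.

Fixpoint sim (c : seq gate) s : state :=
  if c is g :: c' then sim c' (gate_act g s) else s.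

Fixpoint fired (c : seq gate) s : seq state :=
  if c is g :: c' then
    (if g is CV lab q then nseq (s q) lab else [::]) ++ fired c' (gate_act g s)
  else [::].

Definition labels (c : seq gate) : seq state :=
  pmap (fun g => if g is CV lab _ then Some lab else None) c.

Definition is_ccx g := if g is CCX _ _ _ then true else false.
Definition ccxs := count is_ccx.

Definition wf_gate g :=
  match g with
  | CX c t => c != t
  | CCX c1 c2 t => uniq [:: c1; c2; t]
  | _ => true
  end.
Definition wfc := all wf_gate.

Lemma sim_cat c1 c2 s : sim (c1 ++ c2) s = sim c2 (sim c1 s).
Proof. by elim: c1 s => //= g c1 IH s. Qed.

Lemma sim_cons g c s : sim (g :: c) s = sim c (gate_act g s).
Proof. by []. Qed.

Lemma fired_cat c1 c2 s : fired (c1 ++ c2) s = fired c1 s ++ fired c2 (sim c1 s).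
Proof. by elim: c1 s => //= g c1 IH s; rewrite IH catA. Qed.

Lemma wfc_cons g c : wfc (g :: c) = wf_gate g && wfc c. Proof. by []. Qed.

Lemma wfc_cat c1 c2 : wfc (c1 ++ c2) = wfc c1 && wfc c2.
Proof. exact: all_cat. Qed.

Lemma ccxs_cons g c : ccxs (g :: c) = is_ccx g + ccxs c. Proof. by []. Qed.

Lemma ccxs_cat c1 c2 : ccxs (c1 ++ c2) = ccxs c1 + ccxs c2.
Proof. exact: count_cat. Qed.

Lemma togE q e s w : tog q e s w = s w (+) ((w == q) && e).
Proof. by rewrite ffunE. Qed.

Lemma tog_neq q e s w : w != q -> tog q e s w = s w.
Proof. by move=> /negbTE wq; rewrite togE wq addbF. Qed.

Lemma tog_eq q e s : tog q e s q = s q (+) e.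
Proof. by rewrite togE eqxx. Qed.

Lemma togK q e : involutive (tog q e).
Proof. by move=> s; apply/ffunP => w; rewrite !togE addbK. Qed.

Lemma all_tog q e s (cs : seq Q) : q \notin cs -> all (tog q e s) cs = all s cs.
Proof.
move=> qcs; apply: eq_in_all => w wcs; rewrite tog_neq //.
by apply: contraNneq qcs => <-.
Qed.

(* [z ^= AND cs], borrowing the wires [ds] in an arbitrary state *)
Fixpoint mcx z (cs ds : seq Q) : seq gate :=
  match cs, ds with
  | [::], _ => [:: NOT z]
  | [:: c], _ => [:: CX c z]
  | [:: c1; c2], _ => [:: CCX c1 c2 z]
  | c :: cs', d :: ds' =>
      CCX c d z :: mcx d cs' ds' ++ CCX c d z :: mcx d cs' ds'
  | _, _ => [::]
  end.

Lemma mcx_rec z c cs d ds : 1 < size cs ->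
  mcx z (c :: cs) (d :: ds) =
  CCX c d z :: mcx d cs ds ++ CCX c d z :: mcx d cs ds.
Proof. by case: cs => [|c1 [|c2 cs]]. Qed.

(** A recursive call loses one control and one borrowed wire, the latter becoming the new target, so
    the size condition persists. *)
Lemma mcx_ind (P : Q -> seq Q -> seq Q -> Prop) :
  (forall z ds, uniq (z :: [::] ++ ds) -> P z [::] ds) ->
  (forall z c ds, uniq (z :: [:: c] ++ ds) -> P z [:: c] ds) ->
  (forall z c1 c2 ds, uniq (z :: [:: c1; c2] ++ ds) -> P z [:: c1; c2] ds) ->
  (forall z c cs d ds, 1 < size cs -> uniq (z :: (c :: cs) ++ d :: ds) ->
     P d cs ds -> P z (c :: cs) (d :: ds)) ->
  forall z cs ds, uniq (z :: cs ++ ds) -> size cs <= (size ds).+2 -> P z cs ds.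
Proof.
move=> P0 P1 P2 PS z cs; elim: cs z => [|c cs IH] z ds; first by move/P0.
case: cs IH => [|c1 [|c2 cs]] IH; [by move/P1|by move/P2|].
case: ds => [//|d ds] u sz; apply: PS => //; apply: IH => //.
move: u; rewrite cons_uniq => /andP[_]; rewrite cat_cons cons_uniq => /andP[_].
by rewrite -(cat1s d ds) uniq_catCA.
Qed.

(** The two inner calls toggle [d] by the same conjunction and so restore it. Meanwhile [z] receives
    [c d] and [c (d + AND cs)], whose sum modulo 2 is the conjunction of all controls. *)
Lemma sim_mcx z cs ds : uniq (z :: cs ++ ds) -> size cs <= (size ds).+2 ->
  forall s, sim (mcx z cs ds) s = tog z (all s cs) s.
Proof.
move: z cs ds; apply: mcx_ind => [z ds|z c ds|z c1 c2 ds|z c cs d ds sz].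
- by [].
- by move=> _ s; rewrite /= andbT.
- by move=> _ s; rewrite /= andbT.
move=> u IH s; move: u; rewrite mcx_rec //.
rewrite /= !inE !mem_cat !cat_uniq /= !inE !negb_or.
case/and3P=> /and4P[zc zcs zd zds] /and3P[ccs cd cds] /and3P[ucs /andP[dcs _] _].
rewrite sim_cat !IH /= !IH.
have zcs' : forall e s', all (tog z e s') cs = all s' cs.
  by move=> e s'; rewrite all_tog.
have dcs' : forall e s', all (tog d e s') cs = all s' cs.
  by move=> e s'; rewrite all_tog.
apply/ffunP => w; rewrite ?(zcs', dcs') !togE ?(zcs', dcs') !eqxx.
rewrite (eq_sym c z) (eq_sym d z) (negbTE zc) (negbTE zd) (negbTE cd).
by case: (w == z); case: (w == d); case: (s w); case: (s c); case: (s d); case: (all s cs).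
Qed.

Lemma wfc_mcx z cs ds : uniq (z :: cs ++ ds) -> size cs <= (size ds).+2 ->
  wfc (mcx z cs ds).
Proof.
move: z cs ds; apply: mcx_ind => [z ds|z c ds|z c1 c2 ds|z c cs d ds sz].
- by [].
- by rewrite /= inE negb_or eq_sym andbT => /andP[/andP[->]].
- by rewrite /= !inE !negb_or ![z == _]eq_sym => /and3P[/and3P[-> -> _] /andP[-> _] _].
move=> u IH; move: u; rewrite mcx_rec //.
rewrite /= !inE !mem_cat !cat_uniq /= !inE !negb_or.
case/and3P=> /and4P[zc zcs zd zds] /and3P[ccs cd cds] _.
by rewrite /wfc /= all_cat /= -/wfc IH !inE negb_or cd ![_ == z]eq_sym zc zd.
Qed.

Lemma labels_mcx z cs ds : labels (mcx z cs ds) = [::].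
Proof.
elim: cs z ds => [|c [|c1 [|c2 cs]] IH] z [|d ds] //.
by rewrite mcx_rec // /labels /= pmap_cat /= -/(labels _) !IH.
Qed.

Lemma fired_nolabels c s : labels c = [::] -> fired c s = [::].
Proof. by elim: c s => //= -[q|c t|c1 c2 t|lab q] c' IH s //= /IH. Qed.

(** [2 ^ k - 2] solves the recurrence X -> 2 X + 2 of [mcx]; for at most one control it is 0. *)
Lemma ccxs_mcx z cs ds : ccxs (mcx z cs ds) <= 2 ^ size cs - 2.
Proof.
elim: cs z ds => [|c [|c1 [|c2 cs]] IH] z [|d ds] //.
rewrite mcx_rec // /ccxs /= count_cat /= -/(ccxs _).
have /= := IH d ds; rewrite /ccxs /= !expnS.
by have := expn_gt0 2 (size cs); lia.
Qed.

(** * Address labels and firing counts *)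

Context (A : seq Q).

(* As NOT gates accumulate, [lab] is the address whose wires currently all read
   1; those of address [i] then read [lab w == i w].  [S] lists the address wires
   still to be branched on. *)
Definition agree (S : seq Q) lab i :=
  all (fun w => (w \in S) || (lab w == i w)) A.
Definition matches (S : seq Q) lab i s :=
  all (fun w => s w == (lab w == i w)) S.
(** [hits] looks at one run, [occs] at the text of the circuit: correctness needs the former to be
    the indicator of a matching address, while the latter bounds the use of each controlled
    unitary. *)
Definition hits i c s := count (agree [::] ^~ i) (fired c s).
Definition occs i c := count (agree [::] ^~ i) (labels c).

Lemma all_except (P : pred Q) (T S : seq Q) x : x \in T -> x \notin S ->
  all (fun w => (w \in S) || P w) T = P x && all (fun w => (w \in x :: S) || P w) T.
Proof.
move=> xT xS; apply/allP/andP => [h|[hx /allP h] w wT].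
  split; first by have := h x xT; rewrite (negbTE xS).
  by apply/allP => w wT; rewrite inE -orbA h ?orbT.
by have := h w wT; rewrite inE -orbA => /predU1P[->|//]; rewrite hx orbT.
Qed.

Lemma agree_cons x S lab i : x \in A -> x \notin S ->
  agree S lab i = (lab x == i x) && agree (x :: S) lab i.
Proof. exact: all_except. Qed.

Lemma agree_tog x e S lab i : x \in S -> agree S (tog x e lab) i = agree S lab i.
Proof.
move=> xS; apply: eq_in_all => w wA; rewrite togE.
by have [->|_] := eqVneq w x; rewrite ?xS //= addbF.
Qed.

Lemma eq_agree S S' lab i : S =i S' -> agree S lab i = agree S' lab i.
Proof. by move=> e; apply: eq_all => w; rewrite e. Qed.

Lemma hits_cat i c1 c2 s : hits i (c1 ++ c2) s = hits i c1 s + hits i c2 (sim c1 s).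
Proof. by rewrite /hits fired_cat count_cat. Qed.

Lemma hits_nolabels i c s : labels c = [::] -> hits i c s = 0.
Proof. by move=> h; rewrite /hits fired_nolabels. Qed.

Lemma occs_cat i c1 c2 : occs i (c1 ++ c2) = occs i c1 + occs i c2.
Proof. by rewrite /occs /labels pmap_cat count_cat. Qed.

Lemma hits_cons i g c s : hits i (g :: c) s =
  (if g is CV lab q then s q && agree [::] lab i else false) + hits i c (gate_act g s).
Proof. by case: g => //= lab q; rewrite /hits /= count_cat; case: (s q); rewrite //= addn0. Qed.

Lemma occs_cons i g c : occs i (g :: c) =
  (if g is CV lab q then agree [::] lab i else false) + occs i c.
Proof. by case: g. Qed.

Lemma hits_nil i s : hits i [::] s = 0. Proof. by []. Qed.
Lemma occs_nil i : occs i [::] = 0. Proof. by []. Qed.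


Lemma matches_tog x e S lab i s : x \notin S -> matches S lab i (tog x e s) = matches S lab i s.
Proof.
move=> xS; apply: eq_in_all => w wS; rewrite tog_neq //.
by apply: contraNneq xS => <-.
Qed.

Lemma matches_tog_label x e S lab i s : x \notin S -> matches S (tog x e lab) i s = matches S lab i s.
Proof.
move=> xS; apply: eq_in_all => w wS; rewrite tog_neq //.
by apply: contraNneq xS => <-.
Qed.

(* The four values of two address bits in Gray-code order, [l] holding the
   conjunction of [g] with the current values of [a] and [b]. *)
Definition quad a b g u l lab : seq gate :=
  [:: CCX g u l; CV lab l;
      CCX g b l; NOT a; CV (tog a true lab) l;
      CCX g a l; NOT b; CV (tog b true (tog a true lab)) l;
      CCX g b l; NOT a; CV (tog b true lab) l;
      CX a u; CCX g u l; CX a u; NOT b].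

Section Quad.
Context (a b g u l : Q).
Hypothesis uw : uniq [:: a; b; g; u; l].

Lemma quad_neq : (((a == b) = false) * ((a == g) = false) * ((a == u) = false)
  * ((a == l) = false) * ((b == g) = false) * ((b == u) = false) * ((b == l) = false)
  * ((g == u) = false) * ((g == l) = false) * ((u == l) = false))
  * (((b == a) = false) * ((g == a) = false) * ((u == a) = false)
  * ((l == a) = false) * ((g == b) = false) * ((u == b) = false) * ((l == b) = false)
  * ((u == g) = false) * ((l == g) = false) * ((l == u) = false)).
Proof.
have := uw; rewrite /= !inE !negb_or.
case/and5P=> /and4P[ab ag au al] /and3P[bg bu bl] /andP[gu gl] ul _.
by do !split; apply/negbTE => //; rewrite eq_sym.
Qed.

(** The five toggles of [l] carry [g] times [u], [b], [a + 1], [b + 1] and [u + a]; these sum to 0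
    modulo 2 whatever [u] holds. *)
Lemma sim_quad lab s : sim (quad a b g u l lab) s = s.
Proof.
apply/ffunP => w; rewrite /= !togE !(quad_neq, eqxx).
case: (eqVneq w l) => [->|_]; rewrite ?(quad_neq, eqxx).
  by case: (s a); case: (s b); case: (s g); case: (s u); case: (s l).
by case: (w == a); case: (w == b); case: (w == u); case: (s w); case: (s a).
Qed.

Lemma agree_quad i lab : a \in A -> b \in A ->
  agree [::] lab i = [&& lab a == i a, lab b == i b & agree [:: a; b] lab i].
Proof.
move=> aA bA; rewrite (agree_cons _ _ aA) // (agree_cons _ _ bA) ?inE ?quad_neq //.
rewrite (@eq_agree [:: b; a] [:: a; b]) // => w.
by rewrite !inE orbC.
Qed.

(** A Gray-code move complements one factor of the product on [l], that is, adds the other factor,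
    for one Toffoli gate. The first product [a && b] is read off [u]; the last, [a && ~~ b], is [u]
    plus [a], so the final Toffoli gate clears [l]. *)
Lemma hits_quad i lab s : a \in A -> b \in A ->
  s l = false -> (s g -> s u = s a && s b) ->
  hits i (quad a b g u l lab) s =
  [&& s g, agree [:: a; b] lab i & matches [:: a; b] lab i s].
Proof.
move=> aA bA sl su; rewrite !hits_cons hits_nil /= !togE !(quad_neq, eqxx).
rewrite !agree_quad // !agree_tog ?inE ?eqxx ?orbT // !togE !(quad_neq, eqxx) sl.
rewrite /matches /=.
case: (agree _ lab i); last by rewrite !andbF.
case: (s g) su => [->|_] //; case: (s a); case: (s b);
by case: (lab a); case: (lab b); case: (i a); case: (i b).
Qed.

Lemma occs_quad i lab : a \in A -> b \in A ->
  occs i (quad a b g u l lab) = agree [:: a; b] lab i.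
Proof.
move=> aA bA; rewrite !occs_cons occs_nil.
rewrite !agree_quad // !agree_tog ?inE ?eqxx ?orbT // !togE !(quad_neq, eqxx).
case: (agree _ lab i); last by rewrite !andbF.
by case: (lab a); case: (lab b); case: (i a); case: (i b).
Qed.

Lemma wfc_quad lab : wfc (quad a b g u l lab).
Proof. by rewrite /wfc /= !inE !quad_neq. Qed.

End Quad.

Lemma ccxs_quad a b g u l lab : ccxs (quad a b g u l lab) = 5.
Proof. by []. Qed.

(** * Binary tree of indicators *)

Section Tree.
Context (a b f g u l : Q).

Fixpoint tree p (zs ws : seq Q) lab : seq gate :=
  match zs, ws with
  | z :: zs', w :: ws' =>
      CCX p z w :: tree w zs' ws' lab ++
      [:: NOT z; CX p w] ++ tree w zs' ws' (tog z true lab) ++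
      [:: CCX p z w; NOT z]
  | _, _ => CCX f p g :: quad a b g u l lab ++ [:: CCX f p g]
  end.

Local Notation fixed := [:: a; b; f; g; u; l].

Lemma tree_nil p ws lab :
  tree p [::] ws lab = CCX f p g :: quad a b g u l lab ++ [:: CCX f p g].
Proof. by []. Qed.

Lemma tree_cons p z zs w ws lab :
  tree p (z :: zs) (w :: ws) lab =
  CCX p z w :: tree w zs ws lab ++
  [:: NOT z; CX p w] ++ tree w zs ws (tog z true lab) ++ [:: CCX p z w; NOT z].
Proof. by []. Qed.

Lemma tree_uniq p z zs w ws : uniq (p :: (z :: zs) ++ (w :: ws) ++ fixed) ->
  uniq (w :: zs ++ ws ++ fixed) * uniq [:: p; z; w] *
  all (fun x => x \notin [:: p; z; w]) (zs ++ ws ++ fixed).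
Proof.
have e : perm_eq (p :: (z :: zs) ++ (w :: ws) ++ fixed)
                 ([:: p; z; w] ++ zs ++ ws ++ fixed).
  by rewrite /= perm_cons perm_cons -[w :: _ ++ fixed]cat1s perm_catCA.
rewrite (perm_uniq e) cat_uniq => /and3P[u1 /hasPn h u2]; split; last first.
  by apply/allP => x /h.
split=> //; rewrite cons_uniq u2 andbT; apply/negP => /h.
by rewrite !inE eqxx !orbT.
Qed.

Lemma fixed_uniq p ws : uniq (p :: [::] ++ ws ++ fixed) ->
  uniq [:: a; b; g; u; l] * uniq [:: f; p; g] * uniq [:: p; a; b; f; g; u; l].
Proof.
move=> up; have : uniq (p :: fixed).
  by apply: subseq_uniq up; rewrite /= eqxx suffix_subseq.
rewrite /= !inE !negb_or.
case/and3P=> /and5P[pa pb pf pg /andP[pu pl]] /and5P[ab af ag au al].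
case/and3P=> /and4P[bf bg bu bl] /and3P[fg fu fl] /and3P[/andP[gu gl] ul _].
by rewrite (eq_sym f p) pa pb pf pg pu pl ab af ag au al bf bg bu bl fg fu fl gu gl ul.
Qed.


Lemma tree_ind (P : Q -> seq Q -> seq Q -> Prop) :
  (forall p ws, uniq [:: a; b; g; u; l] -> uniq [:: f; p; g] ->
     uniq [:: p; a; b; f; g; u; l] -> P p [::] ws) ->
  (forall p z zs w ws, uniq [:: p; z; w] ->
     all (fun x => x \notin [:: p; z; w]) (zs ++ ws ++ fixed) ->
     uniq (w :: zs ++ ws ++ fixed) -> size zs <= size ws ->
     P w zs ws -> P p (z :: zs) (w :: ws)) ->
  forall p zs ws, uniq (p :: zs ++ ws ++ fixed) -> size zs <= size ws -> P p zs ws.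
Proof.
move=> P0 PS p zs; elim: zs p => [|z zs IH] p [|w ws] // up sz.
- by apply: P0; rewrite (fixed_uniq up).
- by apply: P0; rewrite (fixed_uniq up).
by apply: PS; rewrite ?(tree_uniq up) //; apply: IH; rewrite ?(tree_uniq up).
Qed.

Lemma sim_tree p zs ws : uniq (p :: zs ++ ws ++ fixed) -> size zs <= size ws ->
  forall lab s, sim (tree p zs ws lab) s = s.
Proof.
move: p zs ws; apply: tree_ind => [p ws uq up _|p z zs w ws uw _ _ _ IH] lab s.
- rewrite tree_nil sim_cons sim_cat sim_quad // /= !togE.
  move: up; rewrite /= !inE !negb_or => /and3P[/andP[_ /negbTE ->] /negbTE -> _].
  by rewrite !andFb !addbF togK.
rewrite tree_cons sim_cons sim_cat IH sim_cat sim_cat IH /=.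
apply/ffunP => x; rewrite !togE.
move: uw; rewrite /= !inE !negb_or => /and3P[/andP[/negbTE pz /negbTE pw] /negbTE zw _].
rewrite !eqxx pz pw zw.
by case: (x == w); case: (x == z); case: (s x); case: (s p); case: (s z).
Qed.

Lemma hits_tree i p zs ws : uniq (p :: zs ++ ws ++ fixed) -> size zs <= size ws ->
  a \in A -> b \in A -> {subset zs <= A} ->
  forall lab s, s g = false -> s l = false ->
  (s f -> s u = s a && s b) -> (s f -> all (fun w => ~~ s w) ws) ->
  hits i (tree p zs ws lab) s =
  [&& s f, s p, agree (zs ++ [:: a; b]) lab i & matches (zs ++ [:: a; b]) lab i s].
Proof.
move=> up sz aA bA; move: p zs ws up sz.
apply: tree_ind => [p ws uq _ up|p z zs w ws uw h uw' sz' IH].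
- move=> _ lab s sg sl su _; rewrite /= !inE !negb_or -!andbA in up.
  case/and5P: up => pa pb pf pg /and5P[pu pl ab af /and5P[ag au al bf /and5P[bg bu bl fg]]].
  case/and5P=> fu fl gu gl /andP[ul _].
  have neq x : x != g -> tog g (s f && s p) s x = s x by exact: tog_neq.
  have gE : tog g (s f && s p) s g = s f && s p by rewrite tog_eq sg.
  rewrite tree_nil hits_cons hits_cat hits_quad // ![gate_act _ _]/=.
  + rewrite hits_cons hits_nil gE matches_tog ?addn0 ?andbA //.
    by rewrite !inE !negb_or [g == _]eq_sym ag eq_sym bg.
  + by rewrite neq // eq_sym.
  by rewrite gE !neq // 1?eq_sym // => /andP[/su].
move=> zsA lab s sg sl su sws.
have zA : z \in A by apply: zsA; rewrite mem_head.
have {}IH := IH (fun x xzs => zsA x (mem_behead (s := z :: zs) xzs)).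
rewrite /= !inE !negb_or -!andbA in uw; case/and4P: uw => pz pw zw _.
have off x : x \in zs ++ ws ++ fixed -> [/\ x != p, x != z & x != w].
  by move/(allP h); rewrite !inE !negb_or => /and3P[].
have offS x : x \in zs ++ [:: a; b] -> [/\ x != p, x != z & x != w].
  move=> xS; apply: off; move: xS; rewrite !mem_cat !inE.
  by case/or3P=> ->; rewrite ?orbT.
have zS : z \notin zs ++ [:: a; b] by apply/negP => /offS []; rewrite eqxx.
have wS : w \notin zs ++ [:: a; b] by apply/negP => /offS []; rewrite eqxx.
(* [s1] and [s2] are the states at the start of the two subtrees; they differ from [s] at most in
   [z] and [w], so the hypotheses on the other wires carry over. *)
set s1 := gate_act (CCX p z w) s.
set s2 := gate_act (CX p w) (gate_act (NOT z) s1).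
have s1E x : x \in zs ++ ws ++ fixed -> s1 x = s x.
  by move/off=> [_ _ xw]; rewrite /s1 /= tog_neq.
have s2E x : x \in zs ++ ws ++ fixed -> s2 x = s x.
  by move=> xin; have [_ xz xw] := off _ xin; rewrite /s2 /= !tog_neq ?s1E.
have ff : all (fun x => x \in zs ++ ws ++ fixed) fixed.
  by rewrite /= !mem_cat !inE !eqxx !orbT.
case/and5P: ff => ia ib jf ig /and3P[iu il _].
have s1F := (s1E _ ia, s1E _ ib, s1E _ jf, s1E _ ig, s1E _ iu, s1E _ il).
have s2F := (s2E _ ia, s2E _ ib, s2E _ jf, s2E _ ig, s2E _ iu, s2E _ il).
have inws x : x \in ws -> x \in zs ++ ws ++ fixed by rewrite !mem_cat => ->; rewrite orbT.
rewrite tree_cons hits_cons hits_cat -/s1 IH ?s1F //; last first.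
  by move=> /sws /andP[_ /allP hw]; apply/allP => x xws; rewrite s1E ?hw ?inws.
rewrite sim_tree // hits_cat hits_cons hits_cons hits_nil [sim _ s1]/= -/s2.
rewrite hits_cat IH ?s2F //; last first.
  by move=> /sws /andP[_ /allP hw]; apply/allP => x xws; rewrite s2E ?hw ?inws.
rewrite [hits i [:: CCX _ _ _; _] _]hits_nolabels // addn0 !add0n.
rewrite matches_tog_label // !matches_tog // (agree_cons _ _ zA zS) (agree_cons _ _ zA zS).
rewrite agree_tog ?mem_head // tog_eq.
case sf: (s f) sws => // /(_ isT) /andP[/negbTE sw _].
rewrite /s2 /s1 /= !(tog_eq, togE) ![w == _]eq_sym ?eqxx ?(negbTE pz) ?(negbTE pw) ?(negbTE zw) sw.
case: (agree _ lab i); case: (matches _ lab i s); rewrite ?andbF //.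
by case: (s p); case: (s z); case: (lab z); case: (i z).
Qed.

Lemma occs_tree i p zs ws : uniq (p :: zs ++ ws ++ fixed) -> size zs <= size ws ->
  a \in A -> b \in A -> {subset zs <= A} ->
  forall lab, occs i (tree p zs ws lab) = agree (zs ++ [:: a; b]) lab i.
Proof.
move=> up sz aA bA; move: p zs ws up sz.
apply: tree_ind => [p ws uq _ up _|p z zs w ws uw h uw' sz' IH zsA] lab.
  by rewrite tree_nil occs_cons occs_cat occs_quad // occs_cons occs_nil !addn0.
have zA : z \in A by apply: zsA; rewrite mem_head.
have {}IH := IH (fun x xzs => zsA x (mem_behead (s := z :: zs) xzs)).
have zS : z \notin zs ++ [:: a; b].
  apply/negP => zS; suff /(allP h) : z \in zs ++ ws ++ fixed by rewrite !inE eqxx orbT.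
  by move: zS; rewrite !mem_cat !inE => /or3P[] ->; rewrite ?orbT.
rewrite tree_cons occs_cons occs_cat IH !occs_cons !occs_cat IH !occs_cons occs_nil.
rewrite !(agree_cons _ _ zA zS) agree_tog ?mem_head // tog_eq.
by case: (agree _ lab i); case: (lab z); case: (i z).
Qed.

Lemma wfc_tree p zs ws : uniq (p :: zs ++ ws ++ fixed) -> size zs <= size ws ->
  forall lab, wfc (tree p zs ws lab).
Proof.
move: p zs ws; apply: tree_ind => [p ws uq up _|p z zs w ws uw h uw' sz' IH] lab.
  by rewrite tree_nil wfc_cons wfc_cat wfc_quad // wfc_cons /wf_gate up.
rewrite tree_cons !(wfc_cons, wfc_cat) !IH /wf_gate uw /=.
by move: uw; rewrite /= !inE !negb_or => /and3P[/andP[_ ->] _ _].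
Qed.

(** A leaf costs 7, five for [quad] and two for [g]; a node adds 2 to its two subtrees. *)
Lemma ccxs_tree p zs ws lab : size zs <= size ws ->
  ccxs (tree p zs ws lab) = 9 * 2 ^ size zs - 2.
Proof.
elim: zs p ws lab => [|z zs IH] p [|w ws] lab // sz.
rewrite tree_cons !(ccxs_cons, ccxs_cat) !IH // /= !expnS.
by have := expn_gt0 2 (size zs); lia.
Qed.

End Tree.

(** Interface between the Gray-code walk over the top wires and the circuit run for each top value.
    Restoration holds on every state; [pre] restricts only the statement on firings. *)
Record selects (f : Q) (low : seq Q) (pre : pred state) (body : state -> seq gate) : Prop :=
  Selects {
    sel_wf : forall lab, wfc (body lab);
    sel_sim : forall lab s, sim (body lab) s = s;
    sel_occs : forall i lab, occs i (body lab) = agree low lab i;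
    sel_hits : forall i lab s, pre s ->
      hits i (body lab) s = [&& s f, agree low lab i & matches low lab i s] }.

Definition zero (cl : seq Q) s := all (fun w => ~~ s w) cl.

Lemma zero_tog x e cl s : x \notin cl -> zero cl (tog x e s) = zero cl s.
Proof.
move=> xcl; apply: eq_in_all => w wcl; rewrite tog_neq //.
by apply: contraNneq xcl => <-.
Qed.

Definition workspace a b f u ws cl s :=
  zero cl s && (s f ==> (s u == s a && s b) && zero ws s).

Lemma selects_CV f pre : selects f [::] pre (fun lab => [:: CV lab f]).
Proof.
split=> [//|//|i lab|i lab s _]; rewrite ?occs_cons ?occs_nil ?addn0 //.
by rewrite hits_cons hits_nil addn0 andbT.
Qed.

Lemma selects_quad a b f u l ws cl : uniq [:: a; b; f; u; l] ->
  a \in A -> b \in A -> l \in cl ->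
  selects f [:: a; b] (workspace a b f u ws cl) (quad a b f u l).
Proof.
move=> uw aA bA lcl; split=> [lab|lab s|i lab|i lab s].
- exact: wfc_quad.
- exact: sim_quad.
- exact: occs_quad.
case/andP=> /allP /(_ _ lcl) /negbTE sl /implyP su; apply: hits_quad => //.
by move=> /su /andP[/eqP].
Qed.

Definition block a b f g u l ws z zs lab :=
  tree a b f g u l z zs ws lab ++
  NOT z :: tree a b f g u l z zs ws (tog z true lab) ++ [:: NOT z].

Lemma selects_block a b f g u l ws cl z zs :
  uniq (z :: zs ++ ws ++ [:: a; b; f; g; u; l]) -> size zs <= size ws ->
  {subset z :: zs ++ [:: a; b] <= A} -> l \in cl -> g \in cl -> z \notin cl ->
  selects f (z :: zs ++ [:: a; b]) (workspace a b f u ws cl)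
    (block a b f g u l ws z zs).
Proof.
move=> uw sz sA lcl gcl zcl.
have aA : a \in A by apply: sA; rewrite !(inE, mem_cat) eqxx !orbT.
have bA : b \in A by apply: sA; rewrite !(inE, mem_cat) eqxx !orbT.
have zA : z \in A by apply: sA; rewrite mem_head.
have zsA : {subset zs <= A} by move=> x xzs; apply: sA; rewrite !(inE, mem_cat) xzs orbT.
have := uw; rewrite cons_uniq => /andP[zn _].
have zS : z \notin zs ++ [:: a; b].
  by apply: contra zn; rewrite !mem_cat !inE => /or3P[] ->; rewrite ?orbT.
have zws : z \notin ws by apply: contra zn; rewrite !mem_cat => ->; rewrite ?orbT.
have zx x : x \in [:: a; b; f; g; u; l] -> x != z.
  move=> xin; apply: contraNneq zn => <-; rewrite !mem_cat xin !orbT //.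
split=> [lab|lab s|i lab|i lab s].
- by rewrite /block !(wfc_cat, wfc_cons) !wfc_tree.
- by rewrite /block sim_cat sim_tree // sim_cons sim_cat sim_tree //= togK.
- rewrite /block !(occs_cat, occs_cons) !occs_tree // occs_nil.
  rewrite !(agree_cons _ _ zA zS) agree_tog ?mem_head // tog_eq.
  by case: (agree _ lab i); case: (lab z); case: (i z).
case/andP=> sc /implyP su.
have /negbTE sl := allP sc _ lcl; have /negbTE sg := allP sc _ gcl.
have zxE x : x \in [:: a; b; f; g; u; l] -> tog z true s x = s x.
  by move=> xin; rewrite tog_neq // zx.
have sE : ((tog z true s a = s a) * (tog z true s b = s b) * (tog z true s f = s f)
  * (tog z true s g = s g) * (tog z true s u = s u) * (tog z true s l = s l))%type.
  by do !split; rewrite zxE // !inE eqxx ?orbT.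
have su1 : s f -> s u = s a && s b by move/su => /andP[/eqP].
have su2 : s f -> all (fun w => ~~ s w) ws by move/su => /andP[].
have su3 : s f -> all (fun w => ~~ tog z true s w) ws.
  by move/su => /andP[_]; rewrite -(zero_tog true s zws).
rewrite /block hits_cat (hits_tree i uw) // sim_tree //.
rewrite hits_cons hits_cat (hits_tree i uw) ?sE // sim_tree //.
rewrite [hits i [:: NOT z] _]hits_nolabels // addn0 add0n.
rewrite matches_tog_label // matches_tog // !(agree_cons _ _ zA zS).
rewrite agree_tog ?mem_head // [gate_act _ _]/= !tog_eq /=.
case: (agree _ lab i); case: (matches _ lab i s); rewrite ?andbF //.
by case: (s f); case: (s z); case: (lab z); case: (i z).
Qed.

Lemma ccxs_block a b f g u l ws z zs lab : size zs <= size ws ->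
  ccxs (block a b f g u l ws z zs lab) = 18 * 2 ^ size zs - 4.
Proof.
move=> sz; rewrite /block !(ccxs_cat, ccxs_cons) !ccxs_tree //=.
by have := expn_gt0 2 (size zs); rewrite /ccxs /=; lia.
Qed.

Definition nots (K : seq Q) : seq gate := [seq NOT q | q <- K].

Lemma sim_nots K s : uniq K -> sim (nots K) s = [ffun w => s w (+) (w \in K)].
Proof.
elim: K s => [|q K IH] s; first by move=> _; apply/ffunP=> w; rewrite ffunE addbF.
rewrite /= => /andP[qK uK]; rewrite IH //; apply/ffunP=> w; rewrite !ffunE inE andbT -addbA.
by have [->|_] := eqVneq w q; rewrite ?(negbTE qK) ?addbF ?addFb.
Qed.

Lemma sim_notsK K s : uniq K -> sim (nots K) (sim (nots K) s) = s.
Proof. by move=> uK; rewrite !sim_nots //; apply/ffunP => w; rewrite !ffunE addbK. Qed.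

Lemma labels_nots K : labels (nots K) = [::].
Proof. by elim: K. Qed.

Lemma wfc_nots K : wfc (nots K).
Proof. by elim: K. Qed.

Lemma ccxs_nots K : ccxs (nots K) = 0.
Proof. by elim: K. Qed.

Lemma occs_nolabels i c : labels c = [::] -> occs i c = 0.
Proof. by rewrite /occs => ->. Qed.

(* When [f] is the conjunction of the wires [u :: ws], these are known to be 1
   wherever [f] fires: complementing them makes them conditionally clean. *)
Definition borrow a b u ws (inner : state -> seq gate) lab : seq gate :=
  nots (u :: ws) ++ CCX a b u :: inner lab ++ CCX a b u :: nots (u :: ws).

Lemma selects_borrow a b f u ws cl low inner :
  uniq ([:: a; b; f] ++ u :: ws) -> all (fun w => w \notin u :: ws) cl ->
  all (fun w => w \notin u :: ws) low ->
  selects f low (workspace a b f u ws cl) inner ->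
  selects f low (fun s => zero cl s && (s f == all s (u :: ws))) (borrow a b u ws inner).
Proof.
move=> uw clK lowK [iwf isim iocc ihits].
have uK : uniq (u :: ws) by move: uw; rewrite cat_uniq => /and3P[].
have offK x : x \in [:: a; b; f] -> x \notin u :: ws.
  move=> xin; apply/negP => xK; move: uw; rewrite cat_uniq => /and3P[_ /hasPn /(_ _ xK) /negP].
  exact.
have [aK bK fK] : [/\ a \notin u :: ws, b \notin u :: ws & f \notin u :: ws].
  by split; apply: offK; rewrite !inE eqxx ?orbT.
have [au bu fu] : [/\ a != u, b != u & f != u].
  by move: aK bK fK; rewrite !inE !negb_or => /andP[-> _] /andP[-> _] /andP[-> _].
have ab : a != b by move: uw; rewrite /= !inE !negb_or => /andP[/andP[-> _] _].
split=> [lab|lab s|i lab|i lab s].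
- by rewrite /borrow !(wfc_cat, wfc_cons) !wfc_nots iwf /= !inE negb_or ab au bu.
- have ccxK t : gate_act (CCX a b u) (gate_act (CCX a b u) t) = t.
    by rewrite /= !tog_neq // togK.
  by rewrite /borrow sim_cat sim_cons sim_cat isim sim_cons ccxK sim_notsK.
- by rewrite /borrow !(occs_cat, occs_cons) iocc !occs_nolabels ?labels_nots ?addn0.
case/andP=> scl /eqP sf.
rewrite /borrow hits_cat hits_nolabels ?labels_nots // hits_cons hits_cat.
rewrite hits_cons [hits i (nots _) _]hits_nolabels ?labels_nots // !addn0 !add0n.
rewrite sim_nots //; set s1 := gate_act _ _.
have s1E x : x \notin u :: ws -> s1 x = s x.
  move=> xK; rewrite /s1 /= tog_neq ?ffunE ?(negbTE xK) ?addbF //.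
  by move: xK; rewrite inE negb_or => /andP[].
rewrite ihits.
  rewrite s1E //; congr (nat_of_bool [&& _, _ & _]).
  by apply: eq_in_all => w wlow; rewrite s1E // (allP lowK).
apply/andP; split.
  by apply/allP => w wcl; rewrite s1E ?(allP clK) // (allP scl).
rewrite s1E // sf; apply/implyP => /= /andP[su /allP sws].
have s1u : s1 u = s a && s b.
  by rewrite /s1 /= togE !ffunE mem_head su (negbTE aK) (negbTE bK) !addbF eqxx.
rewrite s1u (s1E a aK) (s1E b bK) eqxx /=.
apply/allP => w wws; rewrite /s1 /= tog_neq ?ffunE ?inE ?wws ?orbT ?sws //.
by apply: contraTneq wws => ->; case/andP: uK.
Qed.

Lemma ccxs_borrow a b u ws inner lab :
  ccxs (borrow a b u ws inner lab) = (ccxs (inner lab)).+2.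
Proof. by rewrite /borrow !(ccxs_cat, ccxs_cons) !ccxs_nots /=; lia. Qed.


(** * Gray-code walk over the top wires *)

Section Gray.
Context (f : Q) (K ds low cl : seq Q) (body : state -> seq gate).
Hypothesis uw : uniq (f :: K ++ ds).
Hypothesis sz : size K <= (size ds).+2.

(** An involution on all states. Conjugation by it expresses the invariant that [f] holds [AND K]:
    clear [f], change [K], recompute [f]. *)
Definition flag s := tog f (all s K) s.

(** Net effect of a walk: the reflected Gray code on [js] ends with only its first wire
    complemented. The second half of a walk thus starts with [j] and the head of the remaining wires
    complemented. *)
Definition flip_head (js : seq Q) s := if js is j :: _ then tog j true s else s.

(* Toggling wire [j] changes [AND K] by the conjunction of the other wires. *)
Definition gray_step j : seq gate := mcx f (rem j K) ds ++ [:: NOT j].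

Fixpoint gray_walk js lab : seq gate :=
  if js is j :: js' then
    gray_walk js' lab ++ gray_step j ++
    gray_walk js' (tog j true (flip_head js' lab))
  else body lab.

Definition gray lab : seq gate :=
  mcx f K ds ++ gray_walk K lab ++
  (if K is j :: _ then gray_step j else [::]) ++ mcx f K ds.

Let fK : f \notin K.
Proof. by move: uw; rewrite cons_uniq mem_cat negb_or -andbA => /andP[]. Qed.

Let uK : uniq K.
Proof. by move: uw; rewrite cons_uniq cat_uniq => /and3P[]. Qed.

Lemma flagK : involutive flag.
Proof. by move=> s; rewrite /flag all_tog // togK. Qed.

Lemma tog_comm q q' e e' s : tog q e (tog q' e' s) = tog q' e' (tog q e s).
Proof. by apply/ffunP => w; rewrite !togE addbAC. Qed.

Lemma gray_step_uniq j : uniq (f :: rem j K ++ ds).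
Proof.
apply: subseq_uniq uw; rewrite /= eqxx; apply: cat_subseq => //; exact: rem_subseq.
Qed.

Lemma size_rem_le j : size (rem j K) <= (size ds).+2.
Proof. exact: leq_trans (size_subseq (rem_subseq _ _)) sz. Qed.

Lemma sim_gray_step j s : j \in K -> sim (gray_step j) s = flag (tog j true (flag s)).
Proof.
move=> jK; rewrite /gray_step sim_cat sim_mcx ?gray_step_uniq ?size_rem_le //=.
have jf : j != f by apply: contraNneq fK => <-.
have jr : j \notin rem j K by rewrite mem_rem_uniqF.
have aK s' : all s' K = s' j && all s' (rem j K) by rewrite (perm_all _ (perm_to_rem jK)).
rewrite /flag !aK tog_comm all_tog // all_tog ?(contra (@mem_rem _ _ _ _) fK) //.
rewrite tog_eq tog_neq //.
apply/ffunP => w; rewrite !togE.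
by case: (w == f); case: (w == j); case: (s w); case: (s j); case: (all s _).
Qed.

(** Adjacent [flag]s cancel, and both halves complement the head of the remaining wires, so only the
    change of [j] survives. *)
Lemma sim_gray_walk js lab s : {subset js <= K} ->
  (forall lab s, sim (body lab) s = s) ->
  sim (gray_walk js lab) s = flag (flip_head js (flag s)).
Proof.
move=> jsK bsim; elim: js jsK lab s => [|j js IH] jsK lab s.
  by rewrite /= bsim flagK.
have jK : j \in K by apply: jsK; rewrite mem_head.
have {}IH := IH (fun x xin => jsK x (mem_behead (s := j :: js) xin)).
rewrite [gray_walk _ _]/= sim_cat sim_cat !IH sim_gray_step // !flagK.
by case: js {IH jsK} => //= h js; rewrite (tog_comm j) togK.
Qed.

Lemma sim_gray lab s : (forall lab s, sim (body lab) s = s) -> sim (gray lab) s = s.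
Proof.
move=> bsim.
have mcxE s' : sim (mcx f K ds) s' = flag s' by rewrite sim_mcx.
rewrite /gray sim_cat sim_cat sim_cat mcxE sim_gray_walk // mcxE flagK.
have close js : {subset js <= K} ->
    sim (if js is j :: _ then gray_step j else [::]) (flag (flip_head js s)) = flag s.
  case: js => // j js sK; rewrite [flip_head _ _]/=.
  by rewrite sim_gray_step ?sK ?mem_head // flagK togK.
by rewrite close // flagK.
Qed.

Lemma ccxs_gray B lab : (forall lab, ccxs (body lab) <= B) -> 0 < size K ->
  ccxs (gray lab) <= 2 ^ size K * (B + (2 ^ (size K).-1 - 2)) + 2 * (2 ^ size K - 2).
Proof.
move=> hB K0; set T := 2 ^ (size K).-1 - 2.
have stepT j : j \in K -> ccxs (gray_step j) <= T.
  move=> jK; rewrite ccxs_cat addn0.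
  by apply: leq_trans (ccxs_mcx _ _ _) _; rewrite size_rem.
(* A walk has one step fewer than it has bodies. Adding [T] evens this out, so the bound doubles
   exactly; in [gray] this extra step is the closing one. *)
have ww js lab' : {subset js <= K} ->
    ccxs (gray_walk js lab') + T <= 2 ^ size js * (B + T).
  elim: js lab' => [|j js IH] lab' jsK; first by rewrite mul1n leq_add2r hB.
  rewrite [gray_walk _ _]/= ccxs_cat ccxs_cat /= expnS -mulnA mul2n -addnn.
  have jsK' : {subset js <= K} := fun x xin => jsK x (mem_behead (s := j :: js) xin).
  have := IH lab' jsK'; have := IH (tog j true (flip_head js lab')) jsK'.
  have := stepT j (jsK j (mem_head _ _)); move: (_ * (B + T)) => X; clearbody T; lia.
rewrite /gray ccxs_cat ccxs_cat ccxs_cat.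
have := ww K lab (fun x h => h); have := ccxs_mcx f K ds.
have : ccxs (if K is j :: _ then gray_step j else [::]) <= T.
  have close js : {subset js <= K} ->
      ccxs (if js is j :: _ then gray_step j else [::]) <= T.
    by case: js => // j js sK; apply: stepT; rewrite sK ?mem_head.
  exact: close.
move: (ccxs (mcx _ _ _)) (ccxs (gray_walk _ _)) (ccxs _) (_ * (B + T)) (2 ^ size K - 2) => ? ? ? X ?; clearbody T; lia.
Qed.

Hypothesis lowK : all (fun w => w \notin f :: K) low.
Hypothesis clK : all (fun w => w \notin f :: K) cl.
Hypothesis sel : selects f low (fun s => zero cl s && (s f == all s K)) body.

Lemma occs_gray_walk i js lab : {subset js <= K} -> uniq js -> {subset K <= A} ->
  occs i (gray_walk js lab) = agree (js ++ low) lab i.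
Proof.
move=> jsK ujs KA; elim: js jsK ujs lab => [|j js IH] jsK /= ujs lab.
  exact: sel_occs sel _ _.
have jK : j \in K by apply: jsK; rewrite mem_head.
have {}IH := IH (fun x xin => jsK x (mem_behead (s := j :: js) xin)).
case/andP: ujs => jjs ujs.
rewrite !occs_cat !IH // (occs_nolabels _ (labels_mcx _ _ _)).
rewrite [occs i [:: NOT j]]occs_nolabels //.
have jS : j \notin js ++ low.
  rewrite mem_cat negb_or jjs; apply/negP => /(allP lowK).
  by rewrite inE jK orbT.
rewrite !(agree_cons _ _ (KA _ jK) jS) agree_tog ?mem_head //.
(* The head of [js] is still to be branched on, so its change in the label is invisible here. The
   labels of the two halves differ at [j], and an address agrees with just one of them. *)
have -> : agree (j :: js ++ low) (flip_head js lab) i = agree (j :: js ++ low) lab i.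
  by case: (js) => //= h js'; rewrite agree_tog // !inE eqxx orbT.
rewrite tog_eq; have -> : flip_head js lab j = lab j.
  by case: (js) jjs => //= h js'; rewrite inE negb_or => /andP[jh _]; rewrite tog_neq.
by case: (agree _ lab i); case: (lab j); case: (i j).
Qed.

(** The wires of [K] outside [js] stay fixed during the walk and must read 1 for [f] ever to be set.
    Those in [js] run through all patterns of complements, just one of which makes them all read 1;
    the label at that moment is the current address. *)
Lemma hits_gray_walk i js lab s : {subset js <= K} -> uniq js -> {subset K <= A} ->
  zero cl s -> s f = all s K ->
  hits i (gray_walk js lab) s =
  [&& agree (js ++ low) lab i, matches (js ++ low) lab i s &
      all (fun w => (w \in js) || s w) K].
Proof.
move=> jsK ujs KA; elim: js jsK ujs lab s => [|j js IH] jsK ujs lab s scl sf.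
  have -> : all (fun w => (w \in [::]) || s w) K = all s K by apply: eq_all.
  rewrite [gray_walk _ _]/= (sel_hits sel) ?scl ?sf ?eqxx //=.
  by case: (all s K); case: (agree _ _ _); case: (matches _ _ _ _).
have jK : j \in K by apply: jsK; rewrite mem_head.
have jsK' : {subset js <= K} := fun x xin => jsK x (mem_behead (s := j :: js) xin).
case/andP: ujs => jjs ujs.
have jS : j \notin js ++ low.
  rewrite mem_cat negb_or jjs; apply/negP => /(allP lowK).
  by rewrite inE jK orbT.
rewrite [gray_walk _ _]/= hits_cat IH // hits_cat hits_nolabels; last first.
  by rewrite /labels pmap_cat -/(labels _) labels_mcx.
rewrite sim_gray_walk //; last by move=> ? ?; apply: sel_sim sel _ _.
rewrite sim_gray_step // flagK add0n.
(* [t] is the change between the starts of the two halves, applied alike to state and label. *)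
pose t s' := tog j true (flip_head js s').
have tE w s' : t s' w = s' w (+) ((w == j) (+) (if js is h :: _ then w == h else false)).
  rewrite /t togE; case: (js) => [|h js'] /=; rewrite ?togE !andbT.
    by rewrite addbF.
  by rewrite -addbA [(w == h) (+) _]addbC.
have tj s' : t s' j = ~~ s' j.
  rewrite tE eqxx; case: (js) jjs => [|h js']; first by rewrite addbF addbT.
  by rewrite inE negb_or => /andP[/negbTE -> _]; rewrite addbF addbT.
have t_off w s' : w \notin j :: js -> t s' w = s' w.
  rewrite inE negb_or tE => /andP[/negbTE -> wjs].
  case: (js) wjs => [|h js']; rewrite ?addbF //.
  by rewrite inE negb_or => /andP[/negbTE -> _]; rewrite !addbF.
have tcomm : tog j true (flip_head js (flag s)) = t (flag s) by [].
rewrite tcomm -[tog j true (flip_head js lab)]/(t lab).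
set s2 := flag _.
have s2E w : w != f -> s2 w = t s w.
  by move=> wf; rewrite /s2 /flag tog_neq // !tE tog_neq.
have s2K w : w \in K -> s2 w = t s w.
  by move=> wK; apply: s2E; apply: contraNneq fK => <-.
have s2f : s2 f = all s2 K.
  rewrite /s2 /flag tog_eq all_tog // t_off.
    by rewrite tog_eq sf addbb.
  by apply: contra fK; rewrite inE => /predU1P[->|/jsK'].
have s2cl : zero cl s2.
  apply/allP => w wcl; have := allP clK _ wcl; rewrite inE negb_or => /andP[wf wK].
  rewrite s2E // t_off ?(allP scl) //.
  by apply: contra wK; rewrite inE => /predU1P[->|/jsK'].
rewrite IH //.
rewrite !(agree_cons _ _ (KA _ jK) jS) !(all_except _ jK jjs) tj s2K // tj.
have -> : agree (j :: js ++ low) (t lab) i = agree (j :: js ++ low) lab i.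
  apply: eq_in_all => w _; have [//|wS] := boolP (w \in _).
  rewrite t_off //; apply: contra wS; rewrite !inE mem_cat => /orP[] ->; rewrite ?orbT //.
(* State and label undergo the same toggles, so their wirewise comparison is unchanged. *)
have -> : matches (js ++ low) (t lab) i s2 = matches (js ++ low) lab i s.
  apply: eq_in_all => w wS; rewrite s2E ?tE.
    by case: ((w == j) (+) _); case: (s w); case: (lab w); case: (i w).
  move: wS; rewrite mem_cat => /orP[/jsK' wK|/(allP lowK)].
    by apply: contraNneq fK => <-.
  by rewrite inE negb_or => /andP[].
have -> : all (fun w => (w \in j :: js) || s2 w) K = all (fun w => (w \in j :: js) || s w) K.
  apply: eq_in_all => w wK; have [//|wS] := boolP (w \in _).
  by rewrite s2K // t_off.
rewrite [matches (_ :: _) _ _ _]/= -/(matches _ _ _ _).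
case: (agree _ lab i); rewrite ?andbF //; case: (matches _ _ _ _); rewrite ?andbF //.
case: (all _ K); rewrite ?andbF //.
by case: (s j); case: (lab j); case: (i j).
Qed.

Lemma hits_gray i lab s : {subset K <= A} -> zero cl s -> s f = false ->
  {subset A <= K ++ low} ->
  hits i (gray lab) s = matches (K ++ low) lab i s.
Proof.
move=> KA scl sf AS; have lmcx := labels_mcx f K ds.
rewrite /gray hits_cat hits_nolabels // sim_mcx // -/(flag s) add0n.
have flagE w : w != f -> flag s w = s w by exact: tog_neq.
have lowE w : w \in K ++ low -> w != f.
  rewrite mem_cat => /orP[wK|/(allP lowK)]; first by apply: contraNneq fK => <-.
  by rewrite inE negb_or => /andP[].
rewrite hits_cat hits_gray_walk //; first last.
- by rewrite /flag tog_eq sf all_tog.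
- apply/allP => w wcl; have := allP clK _ wcl; rewrite inE negb_or => /andP[wf _].
  by rewrite flagE // (allP scl).
rewrite hits_nolabels ?addn0; last first.
  rewrite /labels !pmap_cat -!/(labels _) lmcx cats0.
  by case: (K) => // j K'; rewrite /labels pmap_cat -/(labels _) labels_mcx.
have -> : agree (K ++ low) lab i by apply/allP => w /AS ->.
have -> : all (fun w => (w \in K) || flag s w) K by apply/allP => w ->.
rewrite andbT; congr nat_of_bool; apply: eq_in_all => w /lowE wf.
by rewrite flagE.
Qed.

Lemma occs_gray i lab : {subset K <= A} -> {subset A <= K ++ low} -> occs i (gray lab) = 1.
Proof.
move=> KA AS; have lmcx := labels_mcx f K ds.
rewrite /gray !occs_cat !(occs_nolabels _ lmcx) occs_gray_walk // addn0 add0n.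
rewrite [occs i (if _ is _ :: _ then _ else _)]occs_nolabels; last first.
  by case: (K) => // j K'; rewrite /labels pmap_cat -/(labels _) labels_mcx.
by have -> : agree (K ++ low) lab i by apply/allP => w /AS ->.
Qed.

Lemma wfc_gray_step j : wfc (gray_step j).
Proof. by rewrite wfc_cat wfc_mcx ?gray_step_uniq ?size_rem_le. Qed.

Lemma wfc_gray lab : wfc (gray lab).
Proof.
have ww js lab' : wfc (gray_walk js lab').
  elim: js lab' => [|j js IH] lab'; first exact: sel_wf sel _.
  by rewrite [gray_walk _ _]/= wfc_cat wfc_cat !IH wfc_gray_step.
rewrite /gray wfc_cat wfc_cat wfc_cat wfc_mcx // ww.
by case: (K) => // j K'; rewrite wfc_gray_step.
Qed.

End Gray.
End Reversible.

(** * Unary iteration on Boolean wires *)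

Section Unary.
Context (Q : finType).
Local Notation state := {ffun Q -> bool}.

Record unary_program (A anc : seq Q) (c : seq (gate Q)) : Prop := UnaryProgram {
  unary_wf : wfc c;
  unary_sim : forall s, zero anc s -> sim c s = s;
  unary_hits : forall s i, zero anc s -> hits A i c s = all (fun w => s w == i w) A;
  unary_occs : forall i, occs A i c = 1;
  unary_ccxs : 2 * ccxs c <= 5 * 2 ^ size A }.

(** Initial label: before any NOT gate, the address whose wires all read 1 is the all-ones
    address. *)
Definition ones : state := [ffun=> true].

Lemma matches_ones S i s : matches S ones i s = all (fun w => s w == i w) S.
Proof. by apply: eq_all => w; rewrite ffunE; case: (i w). Qed.

Lemma unary_gray f K ds low cl (body : state -> seq (gate Q)) B :
  uniq (f :: K ++ ds) -> size K <= (size ds).+2 -> 0 < size K ->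
  all (fun w => w \notin f :: K) low -> all (fun w => w \notin f :: K) cl ->
  selects (K ++ low) f low (fun s => zero cl s && (s f == all s K)) body ->
  (forall lab, ccxs (body lab) <= B) ->
  2 * (2 ^ size K * (B + (2 ^ (size K).-1 - 2)) + 2 * (2 ^ size K - 2)) <=
    5 * 2 ^ size (K ++ low) ->
  unary_program (K ++ low) (f :: cl) (gray f K ds body ones).
Proof.
move=> uw sz K0 lowK clK sel hB hT.
have KA : {subset K <= K ++ low} by move=> x xK; rewrite mem_cat xK.
split=> [|s|s i|i|].
- exact: wfc_gray sel _.
- by move=> _; apply: sim_gray => //; apply: sel_sim sel.
- by case/andP=> /negbTE sf scl; rewrite (hits_gray uw sz lowK clK sel) // matches_ones.
- by apply: (occs_gray uw lowK sel).
apply: leq_trans hT; rewrite leq_pmul2l //; exact: ccxs_gray.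
Qed.

(** The iterated logarithm of 1 is 0: with no ancilla, [x] itself controls both unitaries. *)
Lemma unary_one x : exists c, unary_program [:: x] [::] c.
Proof.
exists [:: CV ones x; NOT x; CV (tog x true ones) x; NOT x]; split=> // [s _|s i _|i].
- by rewrite /= togK.
- rewrite !hits_cons hits_nil /agree /= !togE !ffunE eqxx /=.
  by case: (s x); case: (i x).
by rewrite !occs_cons occs_nil /agree /= !togE !ffunE eqxx /=; case: (i x).
Qed.

Lemma unary_two x y l : uniq [:: x; y; l] -> exists c, unary_program [:: x; y] [:: l] c.
Proof.
move=> uw; exists (gray l [:: x; y] [::] (fun lab => [:: CV lab l]) ones).
apply: (@unary_gray l [:: x; y] [::] [::] [::] _ 0) => //.
  by rewrite -(cat1s l) uniq_catC.
exact: selects_CV.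
Qed.


(** Reduces distinctness in a rearranged sublist to inequalities between multiplicities, which
    [uniq_from] leaves to [lia]. *)
Lemma count_le_uniq (s1 s2 : seq Q) : uniq s2 ->
  (forall x, count_mem x s1 <= count_mem x s2) -> uniq s1.
Proof.
move=> u2 h; apply: count_mem_uniq => x.
have [xs1|/count_memPn //] := boolP (x \in s1).
apply/eqP; rewrite eqn_leq -has_count has_pred1 xs1 andbT.
by apply: leq_trans (h x) _; rewrite count_uniq_mem // leq_b1.
Qed.

Lemma uniq_all_notin (S T : seq Q) : uniq (S ++ T) -> all (fun w => w \notin S) T.
Proof. by rewrite cat_uniq all_predC => /and3P[]. Qed.

Ltac uniq_from uw :=
  apply: (count_le_uniq uw) => ?; rewrite /= !count_cat /= ?count_cat /=; lia.

(** Two ancillae suffice because [f] also plays the part of [g] in the only [quad]. The bound 7 is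
    the cost of [quad] plus the two gates of [borrow]. *)
Lemma unary_three_four a b u ws f l :
  uniq ((u :: ws) ++ [:: a; b] ++ [:: f; l]) -> size ws <= 1 ->
  exists c, unary_program ((u :: ws) ++ [:: a; b]) [:: f; l] c.
Proof.
move=> uw szw.
exists (gray f (u :: ws) [:: a; b] (borrow a b u ws (quad a b f u l)) ones).
apply: (@unary_gray _ _ _ _ _ _ 7).
- by uniq_from uw.
- exact: leq_ltn_trans szw _.
- by [].
- by apply: uniq_all_notin; uniq_from uw.
- by apply: uniq_all_notin; uniq_from uw.
- apply: selects_borrow.
  + by uniq_from uw.
  + by apply: uniq_all_notin; uniq_from uw.
  + by apply: uniq_all_notin; uniq_from uw.
  apply: selects_quad; rewrite ?mem_cat ?inE ?eqxx ?orbT //.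
  by uniq_from uw.
- by move=> lab; rewrite ccxs_borrow ccxs_quad.
by case: (ws) szw => [|w [|]].
Qed.

Lemma unary_five a b u ws z zs f g l :
  uniq ((u :: ws) ++ (z :: zs ++ [:: a; b]) ++ [:: f; g; l]) ->
  size zs <= size ws <= (size zs).+1 ->
  exists c, unary_program ((u :: ws) ++ (z :: zs ++ [:: a; b])) [:: f; g; l] c.
Proof.
move=> uw /andP[szw wsz].
exists (gray f (u :: ws) (z :: zs ++ [:: a; b])
  (borrow a b u ws (block a b f g u l ws z zs)) ones).
apply: (@unary_gray _ _ _ _ _ _ (18 * 2 ^ size zs - 2)).
- by uniq_from uw.
- rewrite [size (z :: _)]/= size_cat addn2; apply: (leq_trans (n := (size zs).+2)) => //.
  by rewrite !ltnS -addn3 leq_addr.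
- by [].
- by apply: uniq_all_notin; uniq_from uw.
- by apply: uniq_all_notin; uniq_from uw.
- apply: selects_borrow.
  + by uniq_from uw.
  + by apply: uniq_all_notin; uniq_from uw.
  + by apply: uniq_all_notin; uniq_from uw.
  apply: selects_block; rewrite ?inE ?eqxx ?orbT //.
  + by uniq_from uw.
  + by move=> x xin; rewrite mem_cat xin orbT.
  have : all (fun w => w \notin [:: g; l]) [:: z].
    by apply: uniq_all_notin; uniq_from uw.
  by rewrite /= andbT !inE.
- move=> lab; rewrite ccxs_borrow ccxs_block //.
  have : 0 < 2 ^ size zs by rewrite expn_gt0.
  move: (2 ^ size zs) => r; lia.
have -> : size ((u :: ws) ++ z :: zs ++ [:: a; b]) = (size ws + size zs + 4)%N.
  by rewrite size_cat [size (z :: _)]/= size_cat !addSn !addnS !addn0.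
rewrite [size (u :: ws)]/= [_.-1]/= !expnD expnS.
have : 2 ^ size ws <= 2 * 2 ^ size zs by rewrite -expnS leq_exp2l.
have : 0 < 2 ^ size zs by rewrite expn_gt0.
move: (2 ^ size ws) (2 ^ size zs) => P r r0 Pr.
(* Each of the [2 P] top values has the budget [20 r], which is 5/2 times its [8 r] low values. The
   spare 2 per top value, [4 P] in all, pays for computing and clearing the flag, at most
   [2 (2 P - 2)]. *)
have : 18 * r - 2 + (P - 2) + 2 <= 20 * r by lia.
move: (18 * r - 2 + (P - 2)) => X hX.
have : P * (X + 2) <= P * (20 * r) by rewrite leq_mul2l hX orbT.
rewrite (_ : 2 ^ 4 = 16) // mulnDr; lia.
Qed.

End Unary.

Import Order.TTheory GRing.Theory Num.Theory.
Local Open Scope ring_scope.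
Local Open Scope sesquilinear_scope.

(** * From Boolean simulation to the density-operator semantics *)


Definition bitstring n (x : 'I_(2 ^ n)) : {ffun 'I_n -> bool} :=
  [ffun j : 'I_n => nat_bit x j].

Lemma nat_bitS x j : nat_bit x j.+1 = nat_bit x./2 j.
Proof. by rewrite /nat_bit expnS divnMA divn2. Qed.

Lemma nat_bit_inj n x y : (x < 2 ^ n)%N -> (y < 2 ^ n)%N ->
  (forall j, (j < n)%N -> nat_bit x j = nat_bit y j) -> x = y.
Proof.
elim: n x y => [|n IH] x y; first by rewrite expn0 !ltnS !leqn0 => /eqP-> /eqP->.
rewrite !expnS !mul2n => hx hy h.
have := h 0%N isT; rewrite /nat_bit !expn0 !divn1 => hodd.
rewrite -(odd_double_half x) -(odd_double_half y) hodd; congr (_ + _.*2)%N.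
apply: IH; rewrite ?ltn_half_double // => j jn.
by rewrite -!nat_bitS h.
Qed.

Lemma bitstring_inj n : injective (@bitstring n).
Proof.
move=> x y /ffunP h; apply: val_inj; apply: (@nat_bit_inj n) => [||j jn].
- exact: ltn_ord.
- exact: ltn_ord.
by have := h (Ordinal jn); rewrite !ffunE.
Qed.

Lemma bitstring_onto n (b : {ffun 'I_n -> bool}) : b \in codom (@bitstring n).
Proof. by apply: (inj_card_onto (@bitstring_inj n)); rewrite card_ffun card_bool !card_ord. Qed.

Definition of_bits n (b : {ffun 'I_n -> bool}) : 'I_(2 ^ n) := iinv (bitstring_onto b).

Lemma of_bitsK n : cancel (@of_bits n) (@bitstring n).
Proof. by move=> b; exact: f_iinv. Qed.

Lemma bitstringK n : cancel (@bitstring n) (@of_bits n).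
Proof. by move=> x; apply: bitstring_inj; rewrite of_bitsK. Qed.

(** * Action of the gates on kets *)

Section Simulation.
Context (C : numClosedFieldType) (n m a : nat).
Local Notation D := (2 ^ n * 2 ^ m * 2 ^ a)%N.
Local Notation Q := ('I_n + 'I_a)%type.
Local Notation state := {ffun Q -> bool}.

Definition wireQ (q : Q) : wire n m a :=
  match q with inl j => inl (inl j) | inr j => inr j end.

Lemma wireQ_inj : injective wireQ.
Proof. by case=> [j|j] [k|k] //= [->]. Qed.

Definition selx (x : 'I_D) := (mxtens_unindex (mxtens_unindex x).1).1.
Definition tgtx (x : 'I_D) := (mxtens_unindex (mxtens_unindex x).1).2.
Definition ancx (x : 'I_D) := (mxtens_unindex x).2.

Definition ctl (x : 'I_D) : state := [ffun q => bits x (wireQ q)].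

Lemma ctlE x q : ctl x q = bits x (wireQ q).
Proof. by rewrite ffunE. Qed.

Definition sel_part (b : state) : {ffun 'I_n -> bool} := [ffun j => b (inl j)].
Definition anc_part (b : state) : {ffun 'I_a -> bool} := [ffun j => b (inr j)].

Definition mk (b : state) (t : 'I_(2 ^ m)) : 'I_D :=
  mxtens_index (mxtens_index (of_bits (sel_part b), t), of_bits (anc_part b)).

Lemma ctl_sel x : sel_part (ctl x) = bitstring (selx x).
Proof. by apply/ffunP => j; rewrite !ffunE. Qed.

Lemma ctl_anc x : anc_part (ctl x) = bitstring (ancx x).
Proof. by apply/ffunP => j; rewrite !ffunE. Qed.

Lemma bits_tgt x j : bits x (inl (inr j)) = bitstring (tgtx x) j.
Proof. by rewrite !ffunE. Qed.

Lemma tgt_mk b t : tgtx (mk b t) = t.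
Proof. by rewrite /tgtx /mk !mxtens_indexK. Qed.

Lemma ctl_mk b t : ctl (mk b t) = b.
Proof.
have hs : sel_part (ctl (mk b t)) = sel_part b.
  by rewrite ctl_sel /selx /mk !mxtens_indexK of_bitsK.
have ha : anc_part (ctl (mk b t)) = anc_part b.
  by rewrite ctl_anc /ancx /mk !mxtens_indexK of_bitsK.
by apply/ffunP => -[j|j]; [move/ffunP/(_ j): hs | move/ffunP/(_ j): ha]; rewrite !ffunE.
Qed.

Lemma mkK x : mk (ctl x) (tgtx x) = x.
Proof.
rewrite /mk ctl_sel ctl_anc !bitstringK; apply: etrans (mxtens_unindexK x).
congr (mxtens_index (_, _)); exact: (mxtens_unindexK (mxtens_unindex x).1).
Qed.

Lemma bits_eq x (y : {ffun wire n m a -> bool}) :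
  (forall q, ctl x q = y (wireQ q)) ->
  (forall j, bitstring (tgtx x) j = y (inl (inr j))) -> bits x = y.
Proof.
move=> hq ht; apply/ffunP => -[[j|j]|j].
- by have := hq (inl j); rewrite ffunE.
- by rewrite bits_tgt ht.
- by have := hq (inr j); rewrite ffunE.
Qed.

Lemma bits_mk b t q : bits (mk b t) (wireQ q) = b q.
Proof. by have /ffunP/(_ q) := ctl_mk b t; rewrite ffunE. Qed.

(** The left-hand side is the entry condition of [cnot_mx] and [toffoli_mx] in column [mk b t]; it
    splits into a condition on the control wires and one on the target index. *)
Lemma bits_tog x b t q e :
  (bits x == [ffun w => if w == wireQ q then bits (mk b t) (wireQ q) (+) e
                        else bits (mk b t) w])
  = (ctl x == tog q e b) && (tgtx x == t).
Proof.
apply/eqP/andP => [/ffunP h|[/eqP hc /eqP ht]].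
  split; apply/eqP.
    apply/ffunP => p; rewrite togE ffunE h ffunE (inj_eq wireQ_inj).
    by case: (eqVneq p q) => [->|_]; rewrite bits_mk ?addbF.
  apply/bitstring_inj/ffunP => j; rewrite -bits_tgt h ffunE ifN.
    by rewrite bits_tgt tgt_mk.
  by case: (q).
apply: bits_eq => [p|j]; rewrite [RHS]ffunE.
  rewrite hc togE (inj_eq wireQ_inj).
  by case: (eqVneq p q) => [->|_]; rewrite bits_mk ?addbF.
by rewrite ifN; [rewrite bits_tgt tgt_mk ht | case: (q)].
Qed.

(** The product of the basis state [b] of the control wires with [v] on the target, given by entries
    because the target factor stands between the selection and ancilla factors. *)
Definition ket (b : state) (v : 'cV[C]_(2 ^ m)) : 'cV[C]_D :=
  \col_x ((ctl x == b)%:R * v (tgtx x) 0).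

Lemma mulmx_ket p (M : 'M_(p, D)) b v x :
  (M *m ket b v) x 0 = \sum_t M x (mk b t) * v t 0.
Proof.
rewrite mxE (bigID (fun y => ctl y == b)) /= [X in _ + X]big1 ?addr0; last first.
  by move=> y /negbTE yb; rewrite mxE yb mul0r mulr0.
rewrite (reindex_onto (mk b) tgtx) /=; last by move=> y /eqP <-; rewrite mkK.
apply: eq_big => [t|t _]; first by rewrite ctl_mk tgt_mk !eqxx.
by rewrite mxE ctl_mk eqxx tgt_mk mul1r.
Qed.

Lemma sum_pick (v : 'cV[C]_(2 ^ m)) (c : bool) t0 :
  \sum_t (c && (t0 == t))%:R * v t 0 = c%:R * v t0 0.
Proof.
rewrite (bigD1 t0) //= eqxx andbT big1 ?addr0 // => t /negbTE tt0.
by rewrite eq_sym tt0 andbF mul0r.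
Qed.

Lemma cnot_ket c t b v :
  cnot_mx C (wireQ c) (wireQ t) *m ket b v = ket (tog t (b c) b) v.
Proof.
apply/colP => x; rewrite mulmx_ket [RHS]mxE -sum_pick; apply: eq_bigr => s _.
by rewrite mxE -bits_tog -(bits_mk b s c).
Qed.

Lemma toffoli_ket c1 c2 t b v :
  toffoli_mx C (wireQ c1) (wireQ c2) (wireQ t) *m ket b v =
  ket (tog t (b c1 && b c2) b) v.
Proof.
apply/colP => x; rewrite mulmx_ket [RHS]mxE -sum_pick; apply: eq_bigr => s _.
by rewrite mxE -bits_tog -(bits_mk b s c1) -(bits_mk b s c2).
Qed.

Lemma on_qubit_ket g q b v :
  on_qubit g (wireQ q) *m ket b v =
  g (b q) (b q) *: ket b v + g (~~ b q) (b q) *: ket (tog q true b) v.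
Proof.
apply/colP => x; rewrite mulmx_ket.
have cond s : [forall w, (w != wireQ q) ==> (bits x w == bits (mk b s) w)] =
    (ctl x == tog q (ctl x q (+) b q) b) && (tgtx x == s).
  rewrite -bits_tog; apply/forallP/eqP => [h|/ffunP h w].
    apply/ffunP => w; rewrite [RHS]ffunE; case: (eqVneq w (wireQ q)) => [->|wq].
      by rewrite bits_mk ctlE; case: (b q); case: (bits _ _).
    by have := h w; rewrite wq => /eqP.
  by apply/implyP => /negbTE wq; rewrite h [eqbLHS]ffunE wq.
transitivity (\sum_s g (ctl x q) (b q) *
    (((ctl x == tog q (ctl x q (+) b q) b) && (tgtx x == s))%:R * v s 0)).
  apply: eq_bigr => s _; rewrite mxE cond bits_mk -ctlE.
  by case: ifP => _; rewrite ?mul1r // !mul0r mulr0.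
rewrite -mulr_sumr sum_pick !mxE.
have tog0 : tog q false b = b by apply/ffunP => w; rewrite togE andbF addbF.
have cx e : ctl x == tog q e b -> ctl x q = b q (+) e by move/eqP->; rewrite tog_eq.
have := cx false; have := cx true; rewrite tog0 addbF addbT => cx1 cx0.
case: (boolP (ctl x == b)) => [h0|n0].
  rewrite (cx0 h0) addbb tog0 h0; case: eqP cx1 => [e /(_ isT)|_ _].
    by rewrite (cx0 h0); case: (b q).
  by rewrite mul0r mulr0 addr0.
case: (boolP (ctl x == tog q true b)) => [h1|n1].
  by rewrite (cx1 h1) addNb addbb /= h1 mul0r mulr0 add0r.
by case: (_ (+) _); rewrite ?tog0 ?(negbTE n0) ?(negbTE n1) !mul0r !mulr0 addr0.
Qed.

Definition not_mx q : 'M[C]_D :=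
  on_qubit (@hadamard C) (wireQ q) *m on_qubit (@phase C) (wireQ q)
  *m on_qubit (@phase C) (wireQ q) *m on_qubit (@hadamard C) (wireQ q).

(* X = H Z H with Z = S^2 *)
Lemma not_ket q b v : not_mx q *m ket b v = ket (tog q true b) v.
Proof.
have hr : (sqrtC 2)^-1 * (sqrtC 2)^-1 = 2^-1 :> C.
  by rewrite -invfM -expr2 sqrtCK.
have zk b' : on_qubit (@phase C) (wireQ q) *m (on_qubit (@phase C) (wireQ q) *m ket b' v)
    = (-1) ^+ b' q *: ket b' v.
  rewrite !(on_qubit_ket, mulmxDr) -!scalemxAr !on_qubit_ket /phase eqxx.
  case: (b' q) => /=; rewrite !scale0r !addr0 scalerA ?mul1r //.
  by rewrite -expr2 sqrCi.
rewrite /not_mx -!mulmxA on_qubit_ket !mulmxDr -!scalemxAr !zk -!scalemxAr.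
rewrite !on_qubit_ket !tog_eq togK addbT negbK !scalerDr !scalerA.
rewrite [X in _ + X]addrC addrACA -!scalerDl.
have two : 2^-1 + 2^-1 = 1 :> C by rewrite -[RHS](mulVf (x := 2)) ?pnatr_eq0 //; ring.
rewrite /hadamard.
case: (b q); rewrite /= ?(expr0, expr1, mul1r, mulN1r, mulrN1, mulNr, mulrN, mulr1, opprK) hr two.
  by rewrite addNr scale0r add0r scale1r.
by rewrite subrr scale0r add0r scale1r.
Qed.

Lemma ctrlV_ket (V : 'M[C]_(2 ^ m)) q b v :
  ctrlV_mx V (wireQ q) *m ket b v = ket b (if b q then V *m v else v).
Proof.
have proj e w : qubit_proj C (wireQ q) e *m ket b w = (b q == e)%:R *: ket b w.
  apply/colP => x; rewrite mxE (bigD1 x) //= big1 ?addr0; last first.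
    by move=> y yx; rewrite mxE eq_sym (negbTE yx) mul0r.
  rewrite !mxE eqxx /=; case: (eqVneq (ctl x) b) => [<-|_].
    by rewrite ctlE.
  by rewrite !mul0r !mulr0.
have tens : (1%:M *t V *t 1%:M) *m ket b v = ket b (V *m v).
  apply/colP => x; rewrite mulmx_ket [RHS]mxE [in RHS]mxE mulr_sumr.
  apply: eq_bigr => t _; rewrite mulrA; congr (_ * _).
  rewrite /tensmx !mxE -/(tgtx _) -/(tgtx _) -/(selx _) -/(selx _) -/(ancx _) -/(ancx _).
  rewrite tgt_mk mulrAC; congr (_ * _).
  rewrite -natrM mulnb; congr (_%:R); congr nat_of_bool.
  apply/andP/eqP => [[/eqP hs /eqP ha]|h].
    apply/ffunP => -[j|j].
      by have /ffunP/(_ j) := ctl_sel x; rewrite hs -ctl_sel ctl_mk !ffunE.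
    by have /ffunP/(_ j) := ctl_anc x; rewrite ha -ctl_anc ctl_mk !ffunE.
  by split; apply/eqP/bitstring_inj; rewrite -?ctl_sel -?ctl_anc ctl_mk h.
rewrite /ctrlV_mx mulmxDl -mulmxA tens !proj.
by case: (b q); rewrite /= !(scale0r, scale1r) ?add0r ?addr0.
Qed.

(** * Compilation to quantum circuits *)

Definition compile_gate (g : gate Q) : circuit n m a :=
  match g with
  | NOT q => [:: Clifford (HGate (wireQ q)); Clifford (SGate (wireQ q));
                 Clifford (SGate (wireQ q)); Clifford (HGate (wireQ q))]
  | CX c t => [:: Clifford (CNOT (wireQ c) (wireQ t))]
  | CCX c1 c2 t => [:: Toffoli (wireQ c1) (wireQ c2) (wireQ t)]
  | CV lab q => [:: CtrlV (of_bits (sel_part lab)) (wireQ q)]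
  end.

Definition compile (c : seq (gate Q)) : circuit n m a := flatten (map compile_gate c).

Lemma wf_compile c : wfc c -> wf_circuit (compile c).
Proof.
elim: c => //= g c IH /andP[wg /IH {}IH]; rewrite /wf_circuit all_cat [X in _ && X]IH andbT.
case: g wg => [q|x t|c1 c2 t|lab q] //=; rewrite ?andbT.
- by rewrite (inj_eq wireQ_inj).
- by rewrite !inE !(inj_eq wireQ_inj).
by case: q.
Qed.

Lemma toffoli_compile c : toffoli_count (compile c) = ccxs c.
Proof.
elim: c => //= g c IH; rewrite /toffoli_count count_cat [X in (_ + X)%N]IH.
by case: g.
Qed.

Lemma ctrlV_compile i c :
  ctrlV_count i (compile c) = count (fun lab => of_bits (sel_part lab) == i) (labels c).
Proof.
elim: c => //= g c IH; rewrite /ctrlV_count count_cat [X in (_ + X)%N]IH.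
by case: g => //= lab q; rewrite addn0.
Qed.

Context (V : 'I_(2 ^ n) -> 'M[C]_(2 ^ m)).

Definition gate_mx (g : gate Q) : 'M[C]_D :=
  match g with
  | NOT q => not_mx q
  | CX c t => cnot_mx C (wireQ c) (wireQ t)
  | CCX c1 c2 t => toffoli_mx C (wireQ c1) (wireQ c2) (wireQ t)
  | CV lab q => ctrlV_mx (V (of_bits (sel_part lab))) (wireQ q)
  end.

Fixpoint circuit_mx (c : seq (gate Q)) : 'M[C]_D :=
  if c is g :: c' then circuit_mx c' *m gate_mx g else 1%:M.

Lemma adjM p q r (A : 'M[C]_(p, q)) (B : 'M[C]_(q, r)) : (A *m B)^t* = B^t* *m A^t*.
Proof. by rewrite trmx_mul map_mxM. Qed.

(** No measurement occurs, so there is a single branch and the channel is conjugation by one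
    matrix. *)
Lemma run_compile c h rho :
  run V (compile c) h rho = circuit_mx c *m rho *m (circuit_mx c)^t*.
Proof.
elim: c h rho => [|g c IH] h rho.
  by rewrite /= trmx1 map_mx1 mulmx1 mul1mx.
have -> : run V (compile (g :: c)) h rho =
    run V (compile c) h (gate_mx g *m rho *m (gate_mx g)^t*).
  case: g => [q|x t|c1 c2 t|lab q] //=.
  by rewrite /not_mx !adjM !mulmxA.
by rewrite IH /= adjM !mulmxA.
Qed.

Definition fired_vec (labs : seq state) (v : 'cV[C]_(2 ^ m)) :=
  foldl (fun v lab => V (of_bits (sel_part lab)) *m v) v labs.

Lemma circuit_ket c b v : circuit_mx c *m ket b v = ket (sim c b) (fired_vec (fired c b) v).
Proof.
elim: c b v => [|g c IH] b v; first by rewrite mul1mx.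
rewrite /= -mulmxA.
have -> : gate_mx g *m ket b v =
   ket (gate_act g b) (fired_vec (if g is CV lab q then nseq (b q) lab else [::]) v).
  case: g => [q|x t|c1 c2 t|lab q] /=.
  - exact: not_ket.
  - exact: cnot_ket.
  - exact: toffoli_ket.
  by rewrite ctrlV_ket; case: (b q).
by rewrite IH /fired_vec foldl_cat.
Qed.

(** The isometry that adjoins ancillae in the zero state. Conjugation by it produces [rho *t clean],
    which turns [implements] into an identity between matrices. *)
Definition clean_embed : 'M[C]_(D, 2 ^ n * 2 ^ m) :=
  \matrix_(x, y) (((mxtens_unindex x).1 == y) && (ancx x == 0%N :> nat))%:R.

Lemma clean_embedM (W : 'M[C]_(2 ^ n * 2 ^ m)) x y :
  (clean_embed *m W) x y = (ancx x == 0%N :> nat)%:R * W (mxtens_unindex x).1 y.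
Proof.
rewrite mxE (bigD1 (mxtens_unindex x).1) //= big1 ?addr0.
  by rewrite mxE eqxx.
by move=> z zx; rewrite mxE eq_sym (negbTE zx) mul0r.
Qed.

Lemma tens_clean (rho : 'M[C]_(2 ^ n * 2 ^ m)) :
  rho *t clean C a = clean_embed *m rho *m clean_embed^t*.
Proof.
apply/matrixP => x y; rewrite mxE [RHS]mxE (bigD1 (mxtens_unindex y).1) //= big1 ?addr0.
  rewrite clean_embedM !mxE eqxx /= conjC_nat -mulnb natrM.
  by rewrite -/(ancx x) -/(ancx y) mulrCA mulrA.
by move=> z zy; rewrite !mxE eq_sym (negbTE zy) conjC0 mulr0.
Qed.

Definition start (i : 'I_(2 ^ n)) : state :=
  [ffun q => if q is inl j then bitstring i j else false].

Lemma zero_bits : bitstring (Ordinal (expn_gt0 2 a)) = [ffun=> false].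
Proof. by apply/ffunP => j; rewrite !ffunE /nat_bit div0n. Qed.

Lemma ctl_start x i : (ctl x == start i) = (selx x == i) && (ancx x == 0%N :> nat).
Proof.
have -> : (ancx x == 0%N :> nat) = (ancx x == Ordinal (expn_gt0 2 a)) by [].
apply/eqP/andP => [h|[/eqP hs /eqP ha]].
  split; apply/eqP/bitstring_inj; rewrite -?ctl_sel -?ctl_anc h.
    by apply/ffunP => j; rewrite !ffunE.
  by rewrite zero_bits; apply/ffunP => j; rewrite !ffunE.
apply/ffunP => -[j|j].
  by have /ffunP/(_ j) := ctl_sel x; rewrite hs !ffunE.
by have /ffunP/(_ j) := ctl_anc x; rewrite ha zero_bits !ffunE.
Qed.

Lemma implements_compile c :
  (forall i, sim c (start i) = start i) ->
  (forall i, [seq of_bits (sel_part lab) | lab <- fired c (start i)] = [:: i]) ->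
  implements V (compile c) (unary_iteration V).
Proof.
move=> hsim hfired rho; rewrite run_compile tens_clean.
suff e : circuit_mx c *m clean_embed = clean_embed *m unary_iteration V.
  by rewrite !mulmxA e -!mulmxA -adjM e adjM tens_clean !mulmxA.
apply/matrixP => x y.
set i := (mxtens_unindex y).1; set t := (mxtens_unindex y).2.
(* Each column of the embedding is a ket with clean ancillae and selection value [i], on which the
   simulation fires [V i] alone. *)
have colE : col y clean_embed = ket (start i) (delta_mx t 0).
  apply/colP => z; rewrite !mxE ctl_start -natrM mulnb eqxx andbT.
  congr (_%:R); congr nat_of_bool; rewrite andbAC; congr (_ && _).
  rewrite -{1}[y]mxtens_unindexK -[(mxtens_unindex z).1]mxtens_unindexK.
  by rewrite (inj_eq (can_inj (@mxtens_indexK _ _))).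
have -> : (circuit_mx c *m clean_embed) x y = (circuit_mx c *m col y clean_embed) x 0.
  by rewrite !mxE; apply: eq_bigr => z _; rewrite [col _ _ _ _]mxE.
have fv (labs : seq state) v :
    fired_vec labs v = foldl (fun v j => V j *m v) v [seq of_bits (sel_part lab) | lab <- labs].
  by elim: labs v => //= lab labs IH v; rewrite -IH.
rewrite colE circuit_ket hsim fv hfired /= clean_embedM mxE ctl_start.
rewrite mxE (bigD1 t) //= big1 ?addr0; last first.
  by move=> s st; rewrite mxE (negbTE st) mulr0.
rewrite mxE !eqxx mulr1 andbC -mulnb natrM -mulrA; congr (_ * _).
rewrite /unary_iteration summxE (bigD1 i) //= big1 ?addr0; last first.
  by move=> j ji; rewrite !mxE -/i [i == j]eq_sym (negbTE ji) andbF mul0r.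
by rewrite !mxE eqxx andbT.
Qed.

End Simulation.

(** * Iterated logarithm and towers of 2 *)

Lemma le_tower_log2star (R : realType) (n : nat) :
  (n <= iter (log2star R n) (expn 2) 1)%N.
Proof.
rewrite /log2star; case: ex_minnP => j hj _.
suff tower k (x : R) : iter k (@log2 R) x <= 1 -> x <= (iter k (expn 2) 1%N)%:R.
  by rewrite -(ler_nat R) tower.
elim: k x => [//|k IH] x; rewrite iterSr => /IH /= hx.
(* A nonpositive argument, where [ln] has a default value, lies below every tower. *)
have [x0|x0] := leP x 0; first by rewrite (le_trans x0).
have l2 : 0 < ln 2 :> R by rewrite ln_gt0 // ltr1n.
move: hx; rewrite /log2 ler_pdivrMr // mulr_natl -lnXn ?ltr0n // -natrX.
by rewrite ler_ln ?posrE // ltr0n expn_gt0.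
Qed.

Lemma log2star_gt (R : realType) (n k : nat) :
  (iter k (expn 2) 1 < n)%N -> (k < log2star R n)%N.
Proof.
move=> kn; rewrite ltnNge; apply/negP => jk.
have := leq_trans kn (le_tower_log2star R n); rewrite ltnNge => /negP; apply.
elim: k (log2star R n) jk {kn} => [|k IH] [|j] //= jk; first by rewrite expn_gt0.
by rewrite leq_exp2l // IH.
Qed.

(** * Choice of circuit by the number of selection wires *)

Lemma unary_exists (Q : finType) (sel anc : seq Q) :
  uniq (sel ++ anc) -> (0 < size sel)%N ->
  ((1 < size sel)%N -> (0 < size anc)%N) -> ((2 < size sel)%N -> (1 < size anc)%N) ->
  ((4 < size sel)%N -> (2 < size anc)%N) ->
  exists c anc', {subset anc' <= anc} /\ unary_program sel anc' c.
Proof.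
move=> uw n0 h1 h2 h4.
have sub s t : anc = s ++ t -> {subset s <= anc} by move=> -> x xs; rewrite mem_cat xs.
have usub s t : anc = s ++ t -> uniq (sel ++ s).
  by move=> e; move: uw; rewrite e catA cat_uniq => /and3P[].
have [n4|n4] := leqP (size sel) 4.
  case: sel => [//|x [|y [|a [|b [|]]]]] // in uw n0 h1 h2 h4 n4 usub *.
  - by have [c hc] := unary_one x; exists c, [::].
  - case: anc h1 {h2 h4} => [/(_ isT) //|l anc] _ in uw sub usub *.
    have [|c hc] := @unary_two _ x y l; first exact: (usub [:: l] anc).
    by exists c, [:: l]; split=> //; apply: (sub _ anc).
  - case: anc h2 {h1 h4} => [/(_ isT) //|f [/(_ isT) //|l anc]] _ in uw sub usub *.
    have [||c hc] := @unary_three_four _ y a x [::] f l; [exact: (usub [:: f; l] anc) | by [] |].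
    by exists c, [:: f; l]; split=> //; apply: (sub _ anc).
  case: anc h2 {h1 h4} => [/(_ isT) //|f [/(_ isT) //|l anc]] _ in uw sub usub *.
  have [||c hc] := @unary_three_four _ a b x [:: y] f l; [exact: (usub [:: f; l] anc) | by [] |].
  by exists c, [:: f; l]; split=> //; apply: (sub _ anc).
have := h4 n4; case eA: {1}anc => [//|f [//|g [//|l anc3]]] _.
(* The low part consists of [z], [r] further tree wires and the pair [a], [b], hence [r + 3] wires;
   halving leaves [k] equal to [r + 1] or [r + 2]. *)
pose r := (size sel - 4)./2; pose k := (size sel - r.+3)%N.
have rk : (r < k <= r.+2)%N by rewrite /k /r; move: (size sel) n4; lia.
have kn : (k + r.+3 = size sel)%N by rewrite /k /r; move: (size sel) n4; lia.
have eK : size (take k sel) = k by rewrite size_takel // -kn leq_addr.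
have eL : size (drop k sel) = r.+3 by rewrite size_drop -kn addKn.
case: (take k sel) eK (cat_take_drop k sel) => [|u ws] eK; first by move: rk; rewrite -eK.
case: (drop k sel) eL => [//|z low] eL.
have eZ : size (take r low) = r by rewrite size_takel //; case: eL => ->; rewrite -addn2 leq_addr.
have eD : size (drop r low) = 2 by rewrite size_drop; case: eL => ->; rewrite -addn2 addKn.
rewrite -(cat_take_drop r low).
case: (drop r low) eD => [//|a [//|b [|//]]] _ e.
have uw' : uniq (sel ++ [:: f; g; l]) by exact: (usub [:: f; g; l] anc3 eA).
rewrite -e -catA in uw'.
have szs : (size (take r low) <= size ws <= (size (take r low)).+1)%N.
  by rewrite eZ; move: rk; rewrite -eK /= !ltnS.
have [c hc] := unary_five uw' szs.
exists c, [:: f; g; l]; split; first exact: (sub [:: f; g; l] anc3 eA).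
by rewrite -e.
Qed.

Theorem mainTheorem4 (R : realType) (n m : nat) (hn : (1 <= n)%N) (hm : (1 <= m)%N)
    (V : 'I_(2 ^ n) -> 'M[R[i]%C]_(2 ^ m))
    (hV : forall i, V i \is unitarymx) :
  exists c : circuit n m (log2star R n),
    [/\ wf_circuit c,
        implements V c (unary_iteration V),
        (toffoli_count c)%:R <= 5 / 2 * (2 ^ n)%:R :> rat
      & forall i : 'I_(2 ^ n), ctrlV_count i c = 1%N].
Proof.
set a := log2star R n.
pose sel : seq ('I_n + 'I_a)%type := [seq inl j | j <- enum 'I_n].
pose anc : seq ('I_n + 'I_a)%type := [seq inr j | j <- enum 'I_a].
have szs : size sel = n by rewrite size_map size_enum_ord.
have sza : size anc = a by rewrite size_map size_enum_ord.
have uw : uniq (sel ++ anc).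
  rewrite cat_uniq; apply/and3P; split.
  - by rewrite map_inj_uniq ?enum_uniq // => ? ? [].
  - by apply/hasPn => _ /mapP[j _ ->]; apply/mapP => -[].
  by rewrite map_inj_uniq ?enum_uniq // => ? ? [].
have [||||] := unary_exists uw; rewrite ?szs ?sza //.
(* The towers of heights 0, 1, 2 are 1, 2, 4, the very thresholds at which another ancilla is
   required. *)
- exact: (@log2star_gt R n 0).
- exact: (@log2star_gt R n 1).
- exact: (@log2star_gt R n 2).
move=> c [anc' [hsub [hwf hsim hhits hoccs hccx]]].
have agreeE lab (i : 'I_(2 ^ n)) :
    agree sel [::] lab (start a i) = (of_bits (sel_part lab) == i).
  apply/allP/eqP => [h|<- _ /mapP[j _ ->]].
    apply: bitstring_inj; rewrite of_bitsK; apply/ffunP => j.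
    have /h : (inl j : 'I_n + 'I_a) \in sel by rewrite map_f ?mem_enum.
    by rewrite !ffunE => /eqP.
  by rewrite [start _ _ _]ffunE of_bitsK ffunE eqxx orbT.
have z i : zero anc' (start a i).
  by apply/allP => _ /hsub /mapP[j _ ->]; rewrite ffunE.
have fired1 i : [seq of_bits (sel_part lab) | lab <- fired c (start a i)] = [:: i].
  (* [hits] gives the multiplicity of every index among the fired ones: 1 at [i] and 0 elsewhere. A
     permutation of a singleton is that singleton. *)
  apply: perm_small_eq => //; apply/allP => j _ /=.
  rewrite addn0 count_map; have := hhits _ (start a j) (z i).
  have -> : all (fun w => start a i w == start a j w) sel = (i == j).
    have := agreeE (start a i) j; rewrite /agree /= => ->.
    by congr (_ == j); apply: bitstring_inj; rewrite of_bitsK; apply/ffunP=> k; rewrite !ffunE.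
  by move=> <-; rewrite /hits; apply/eqP; apply: eq_count => lab /=; rewrite agreeE.
exists (compile m c); split.
- exact: wf_compile.
- by apply: implements_compile => // i; rewrite hsim.
- rewrite toffoli_compile; move: hccx; rewrite szs -(ler_nat rat) !natrM.
  by move: ((ccxs c)%:R : rat) ((2 ^ n)%:R : rat) => x y; lra.
move=> i; rewrite ctrlV_compile; apply: etrans (hoccs (start a i)).
by apply: eq_count => lab /=; rewrite agreeE.
Qed.
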